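(* Let $G_1=\langle S_1\rangle$ and $G_2=\langle S_2\rangle$ be two non-trivial finitely generated groups, with $S_1,S_2$ finite generating sets. Consider Bernoulli bond percolation on the Cayley graph of the free product $G_1*G_2$ with respect to the generating set $S_1\cup S_2$, and let $p_c$ be its critical probability. For $i=1,2$ let $\chi_i(p)=\mathrm{E}_p(|C|_{G_i})\in[1,\infty]$ denote the expected size of the cluster containing the origin in the Cayley graph of $G_i$ with respect to $S_i$. Then $0<p_c\le 1$, and $p_c$ is the unique solution $p\in(0,1]$ of the equation $$(\chi_1(p)-1)(\chi_2(p)-1)=1.$$
   Context: Cayley graph: for a group $G$ with finite generating set $S$, the graph has vertex set $G$, and $g,h$ are adjacent iff $g^{-1}h\in S$ or $h^{-1}g\in S$, with the appropriate multiplicity (one edge joining $g$ and $gs$ for each pair $(g,s)\in G\times S$). The origin $o$ is the identity element. Bernoulli bond percolation with parameter $p\in[0,1]$ on a graph: each edge is independently open with probability $p$ and closed otherwise; $\mathrm{P}_p$ is the resulting product probability measure and $\mathrm{E}_p$ its expectation. A cluster is a connected component of the random subgraph (on all vertices) of open edges; $C$ is the cluster containing $o$, and $|C|$ is its number of vertices (written $|C|_G$ when the graph is the Cayley graph of $G$). The percolation function is $\theta(p)=\mathrm{P}_p(|C|=\infty)$ and the critical probability is $p_c=\inf\{p\in[0,1]:\theta(p)>0\}$. *)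

(* Defs.v *)
From HB Require Import structures.
From mathcomp Require Import all_boot all_order all_algebra finmap.
From mathcomp Require Import all_classical all_reals all_analysis.
From mathcomp Require Import measurable_realfun.
From mathcomp Require Import ring lra.
From Stdlib Require Import Relation_Operators.
Set Implicit Arguments.
Unset Strict Implicit.
Unset Printing Implicit Defensive.
Import Order.TTheory GRing.Theory Num.Theory.
Import numFieldNormedType.Exports.
Local Open Scope classical_set_scope.
Local Open Scope ring_scope.

(* The free product is realized on reduced words; freeProd_universal below
   shows that it is the coproduct of G1 and G2. *)
Section FreeProduct.
Local Open Scope group_scope.
Variables G1 G2 : groupType.
Implicit Types (w u v : seq (G1 + G2)) (x y : G1 + G2).

Definition side x : bool := if x is inl _ then true else false.

Definition trivial_letter x : bool :=
  match x with inl a => a == 1 | inr b => b == 1 end.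

(* Reduced words: no trivial letter, consecutive letters in different factors. *)
Definition reduced w : bool :=
  all (predC trivial_letter) w && sorted (fun x y => side x != side y) w.

(* Left multiplication of a reduced word by a single letter. *)
Definition lcons x w : seq (G1 + G2) :=
  match x, w with
  | inl a, inl b :: w' => if a * b == 1 then w' else inl (a * b) :: w'
  | inr a, inr b :: w' => if a * b == 1 then w' else inr (a * b) :: w'
  | _, _ => if trivial_letter x then w else x :: w
  end.

Definition letter_inv x : G1 + G2 :=
  match x with inl a => inl a^-1 | inr b => inr b^-1 end.

Definition word_mul u v := foldr lcons v u.
Definition word_inv u := rev (map letter_inv u).

Lemma reduced_tail x w : reduced (x :: w) -> reduced w.
Proof. by case/andP => /andP[_ ha] /path_sorted hs; apply/andP. Qed.

Lemma reduced_lcons x w : reduced w -> reduced (lcons x w).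
Proof.
case: w => [|y w]; first by case: x => a /=; case: ifP => //; rewrite /reduced /= => ->.
rewrite /reduced; case: x y => [a|a] [b|b] /=; case: ifP => //= h;
  case/andP => /andP[h1 h2] h3; rewrite ?h ?h1 ?h2 /= ?(path_sorted h3) //;
  by move: h3; case: (w) => //= z s.
Qed.

Lemma reduced_word_mul u v : reduced v -> reduced (word_mul u v).
Proof. by move=> hv; elim: u => //= x u IH; apply: reduced_lcons. Qed.

Lemma lcons1l w : reduced w -> lcons (inl 1) w = w.
Proof.
by case: w => [|[b|b] w]; rewrite /= ?eqxx ?mul1g // => /andP[/andP[/negPf /= ->]].
Qed.

Lemma lcons1r w : reduced w -> lcons (inr 1) w = w.
Proof.
by case: w => [|[b|b] w]; rewrite /= ?eqxx ?mul1g // => /andP[/andP[/negPf /= ->]].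
Qed.

Lemma lcons_id x w : reduced (x :: w) -> lcons x w = x :: w.
Proof.
move=> rxw; have tx : trivial_letter x = false.
  by case/andP: rxw => /andP[/negPf].
case: w rxw => [|y w]; first by case: x tx => a /= ->.
by case: x y tx => [a|a] [b|b] //= tx; rewrite ?tx // /reduced /= andbF.
Qed.

Lemma lconsMl a b w : reduced w ->
  lcons (inl a) (lcons (inl b) w) = lcons (inl (a * b)) w.
Proof.
have aux c d s : reduced s -> (if c == 1 then s else inl c :: s) = lcons (inl c) s ->
  (if d * c == 1 then s else inl (d * c) :: s) = lcons (inl (d * c)) s ->
  lcons (inl d) (if c == 1 then s else inl c :: s) = lcons (inl (d * c)) s.
  move=> rs h1 h2; case: ifP h1 h2 => [/eqP -> _ _|hc _ <-]; by rewrite ?mulg1.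
case: w => [|[c|c] w] rw.
- exact: aux.
- rewrite [X in lcons _ X = _]/= [RHS]/=.
  have rw' := reduced_tail rw.
  have hN e : (if e == 1 then w else inl e :: w) = lcons (inl e) w.
    by case: w rw {rw'} => [|[d|d] w]; rewrite /reduced //= andbF.
  by rewrite aux // -mulgA hN.
- exact: aux.
Qed.

Lemma lconsMr a b w : reduced w ->
  lcons (inr a) (lcons (inr b) w) = lcons (inr (a * b)) w.
Proof.
have aux c d s : reduced s -> (if c == 1 then s else inr c :: s) = lcons (inr c) s ->
  (if d * c == 1 then s else inr (d * c) :: s) = lcons (inr (d * c)) s ->
  lcons (inr d) (if c == 1 then s else inr c :: s) = lcons (inr (d * c)) s.
  move=> rs h1 h2; case: ifP h1 h2 => [/eqP -> _ _|hc _ <-]; by rewrite ?mulg1.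
case: w => [|[c|c] w] rw.
- exact: aux.
- exact: aux.
- rewrite [X in lcons _ X = _]/= [RHS]/=.
  have rw' := reduced_tail rw.
  have hN e : (if e == 1 then w else inr e :: w) = lcons (inr e) w.
    by case: w rw {rw'} => [|[d|d] w]; rewrite /reduced //= andbF.
  by rewrite aux // -mulgA hN.
Qed.

Lemma word_mul_lcons x v w : reduced w ->
  word_mul (lcons x v) w = lcons x (word_mul v w).
Proof.
move=> rw; have rm u := reduced_word_mul u rw.
have gen y u : word_mul (if trivial_letter y then u else y :: u) w =
    lcons y (word_mul u w).
  case: y => c; rewrite [trivial_letter _]/=; case: ifP => // /eqP ->.
    by rewrite lcons1l.
  by rewrite lcons1r.
case: v => [|y v]; first by case: x => a; exact: gen.
case: x y => [a|a] [b|b]; try exact: gen.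
- rewrite [lcons _ (_ :: _)]/= [word_mul (_ :: _) _ in RHS]/= lconsMl //.
  exact: (gen (inl (a * b))).
- rewrite [lcons _ (_ :: _)]/= [word_mul (_ :: _) _ in RHS]/= lconsMr //.
  exact: (gen (inr (a * b))).
Qed.

Lemma word_mulA u v w : reduced w ->
  word_mul u (word_mul v w) = word_mul (word_mul u v) w.
Proof. by move=> rw; elim: u => //= x u ->; rewrite word_mul_lcons. Qed.

Lemma word_mul0 u : reduced u -> word_mul u [::] = u.
Proof.
by elim: u => //= x u IH ru; rewrite IH ?lcons_id //; apply: reduced_tail ru.
Qed.

Lemma reduced_word_inv u : reduced u -> reduced (word_inv u).
Proof.
rewrite /reduced /word_inv all_rev rev_sorted all_map sorted_map.
case/andP => h1 h2; apply/andP; split.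
  by apply: sub_all h1 => -[a|a] /=; rewrite invg_eq1.
by apply: sub_sorted h2 => -[a|a] [b|b].
Qed.

Lemma word_mulVg u : word_mul (word_inv u) u = [::].
Proof.
have lV x w : lcons (letter_inv x) (x :: w) = w.
  by case: x => a /=; rewrite mulVg eqxx.
suff h w : word_mul (word_inv u) (u ++ w) = w by rewrite -{2}[u]cats0 h.
elim: u w => //= x u IH w.
by rewrite /word_inv map_cons rev_cons -cats1 /word_mul foldr_cat /= lV; exact: IH.
Qed.

Lemma word_invK : involutive word_inv.
Proof.
move=> u; rewrite /word_inv map_rev revK -map_comp map_id_in // => -[a|a] _ /=;
  by rewrite invgK.
Qed.

Record freeProd := FreeProd { fpword :> seq (G1 + G2); fpwordP : reduced fpword }.

HB.instance Definition _ := [isSub for fpword].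
HB.instance Definition _ := [Choice of freeProd by <:].

Definition fp_one : freeProd := FreeProd (erefl : reduced [::]).
Definition fp_mul (u v : freeProd) : freeProd :=
  FreeProd (reduced_word_mul u (fpwordP v)).
Definition fp_inv (u : freeProd) : freeProd :=
  FreeProd (reduced_word_inv (fpwordP u)).

Lemma fp_mulA : associative fp_mul.
Proof. by move=> u v w; apply: val_inj; apply: word_mulA; apply: fpwordP. Qed.

Lemma fp_mul1g : left_id fp_one fp_mul.
Proof. by move=> u; apply: val_inj. Qed.

Lemma fp_mulg1 : right_id fp_one fp_mul.
Proof. by move=> u; apply: val_inj; apply: word_mul0; apply: fpwordP. Qed.

Lemma fp_mulVg : left_inverse fp_one fp_inv fp_mul.
Proof. by move=> u; apply: val_inj; apply: word_mulVg. Qed.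

Lemma fp_mulgV : right_inverse fp_one fp_inv fp_mul.
Proof.
by move=> u; apply: val_inj; rewrite /= -{1}[fpword u]word_invK; apply: word_mulVg.
Qed.

HB.instance Definition _ :=
  isGroup.Build freeProd fp_mulA fp_mul1g fp_mulg1 fp_mulVg fp_mulgV.

Lemma reduced_lcons1 x : reduced (lcons x [::]).
Proof. exact: reduced_lcons. Qed.

Definition fpinl (a : G1) : freeProd := FreeProd (reduced_lcons1 (inl a)).
Definition fpinr (b : G2) : freeProd := FreeProd (reduced_lcons1 (inr b)).

Lemma fpinlM : {morph fpinl : a b / a * b}.
Proof.
move=> a b; apply: val_inj; rewrite -[LHS]/(lcons (inl (a * b)) [::]).
rewrite -[RHS]/(word_mul (lcons (inl a) [::]) (lcons (inl b) [::])).
by rewrite word_mul_lcons ?lconsMl //; exact: reduced_lcons.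
Qed.

Lemma fpinrM : {morph fpinr : a b / a * b}.
Proof.
move=> a b; apply: val_inj; rewrite -[LHS]/(lcons (inr (a * b)) [::]).
rewrite -[RHS]/(word_mul (lcons (inr a) [::]) (lcons (inr b) [::])).
by rewrite word_mul_lcons ?lconsMr //; exact: reduced_lcons.
Qed.

HB.instance Definition _ := isMultiplicative.Build G1 freeProd fpinl fpinlM.
HB.instance Definition _ := isMultiplicative.Build G2 freeProd fpinr fpinrM.

Definition fpletter x : freeProd := match x with inl a => fpinl a | inr b => fpinr b end.

Lemma fp_prod (u : freeProd) : u = \prod_(x <- fpword u) fpletter x.
Proof.
case: u => u ru /=; apply: val_inj => /=.
elim: u ru => [|x u IH] ru; first by rewrite big_nil.
rewrite big_cons /=.
have -> : fpword (fpletter x) = lcons x [::] by case: x {ru}.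
rewrite word_mul_lcons /=; last exact: fpwordP.
by rewrite -IH ?lcons_id //; apply: reduced_tail ru.
Qed.

Lemma freeProd_universal (H : groupType)
    (f1 : {multiplicative G1 -> H}) (f2 : {multiplicative G2 -> H}) :
  (exists f : {multiplicative freeProd -> H},
    (forall a, f (fpinl a) = f1 a) /\ (forall b, f (fpinr b) = f2 b)) /\
  (forall f g : {multiplicative freeProd -> H},
    (forall a, f (fpinl a) = g (fpinl a)) ->
    (forall b, f (fpinr b) = g (fpinr b)) -> f =1 g).
Proof.
have m1 (K : groupType) (k : {multiplicative K -> H}) : k 1 = 1.
  by apply: (@mulgI _ (k 1)); rewrite -gmulfM !mulg1.
split; last first.
  move=> f g fg1 fg2 u; rewrite (fp_prod u).
  elim: (fpword u) => [|x w IH]; first by rewrite big_nil !m1.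
  by rewrite big_cons !gmulfM IH; case: x => a; rewrite ?fg1 ?fg2.
pose h x := match x with inl a => f1 a | inr b => f2 b end.
pose F (u : freeProd) : H := \prod_(x <- fpword u) h x.
have Fl x w : \prod_(y <- lcons x w) h y = h x * \prod_(y <- w) h y.
  case: x w => [a|a] [|[b|b] w] /=; case: ifP => /eqP e;
    rewrite ?big_cons /= ?mulgA -?gmulfM ?e ?m1 ?mul1g //.
have FM : {morph F : u v / u * v}.
  move=> [u ru] [v rv]; rewrite /F /=.
  by elim: u {ru} => [|x u IH] /=; rewrite ?big_nil ?mul1g // Fl IH big_cons mulgA.
pose Fm := isMultiplicative.Build freeProd H F FM.
pose f : {multiplicative freeProd -> H} := HB.pack F Fm.
have fE (u : freeProd) : f u = F u by [].
exists f; split => a; rewrite fE.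
  by have := Fl (inl a) [::]; rewrite big_nil mulg1.
by have := Fl (inr a) [::]; rewrite big_nil mulg1.
Qed.
End FreeProduct.
Arguments fpinl {G1} G2 a.
Arguments fpinr G1 {G2} b.

Definition nontrivial (G : groupType) : Prop := exists g : G, g <> 1%g.

Definition generates (G : groupType) (S : {fset G}) : Prop :=
  forall H : {pred G}, group_closed H -> {subset S <= H} -> forall g, g \in H.

Definition freeProd_gens (G1 G2 : groupType) (S1 : {fset G1}) (S2 : {fset G2}) :
    {fset freeProd G1 G2} :=
  ([fset fpinl G2 s | s in S1] `|` [fset fpinr G1 s | s in S2])%fset.

Lemma freeProd_generated (G1 G2 : groupType) (S1 : {fset G1}) (S2 : {fset G2}) :
  generates S1 -> generates S2 -> generates (freeProd_gens S1 S2).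
Proof.
move=> gen1 gen2 H [H1 HB] HS u.
have HV x : x \in H -> (x^-1)%g \in H.
  by move=> xH; rewrite -(mul1g x^-1%g); exact: HB.
have HM x y : x \in H -> y \in H -> (x * y)%g \in H.
  by move=> xH yH; rewrite -(invgK y); apply: HB => //; exact: HV.
have mV (K : groupType) (f : {multiplicative K -> freeProd G1 G2}) :
    f 1%g = 1%g /\ (forall x, f x^-1%g = (f x)^-1%g).
  have f1 : f 1%g = 1%g by apply: (@mulgI _ (f 1%g)); rewrite -gmulfM !mulg1.
  by split=> // x; apply/esym/mulg1_eq; rewrite -gmulfM mulgV.
have pre (K : groupType) (f : {multiplicative K -> freeProd G1 G2}) (S : {fset K}) :
    generates S -> (forall s, s \in S -> f s \in H) -> forall g, f g \in H.
  have [f1 fV] := mV K f => genS fS; apply: (genS [pred g | f g \in H]) => //.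
  by split=> [|x y]; rewrite !inE ?f1 // gmulfM fV => xH yH; exact: HB.
rewrite (fp_prod u); elim: (fpword u) => [|x w IH]; first by rewrite big_nil.
rewrite big_cons; apply: HM => //; case: x => a /=.
  apply: (pre _ (fpinl G2) S1 gen1) => s sS; apply: HS.
  by apply/fsetUP; left; apply/imfsetP; exists s.
apply: (pre _ (fpinr G1) S2 gen2) => s sS; apply: HS.
by apply/fsetUP; right; apply/imfsetP; exists s.
Qed.

Lemma generates_countable (G : groupType) (S : {fset G}) :
  generates S -> countable [set: G].
Proof.
move=> genS.
pose f (w : seq (bool * S)) : G :=
  (\prod_(x <- w) (if x.1 then val x.2 else (val x.2)^-1))%g.
have fM v w : f (v ++ w) = (f v * f w)%g by rewrite /f big_cat.
have fV w : exists v, f v = ((f w)^-1)%g.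
  exists (rev [seq (~~ x.1, x.2) | x <- w]).
  elim: w => [|[b x] w IH]; first by rewrite /f !big_nil invg1.
  rewrite map_cons rev_cons -cats1 fM IH /f big_seq1 big_cons invgM; congr (_ * _)%g.
  by case: b; rewrite //= invgK.
have fT : [set: G] `<=` range f.
  move=> g _; have /asboolP[w] : g \in [pred g | `[< exists w, f w = g >]].
    apply: genS.
      split; first by apply/asboolP; exists [::]; rewrite /f big_nil.
      move=> x y /asboolP[v <-] /asboolP[w <-]; apply/asboolP.
      by have [w' <-] := fV w; exists (v ++ w'); rewrite fM.
    move=> s sS; apply/asboolP; exists [:: (true, [` sS]%fset)].
    by rewrite /f big_seq1.
  by exists w.
by apply: sub_countable (subset_card_le fT) _; apply: card_le_trans (card_image_le _ _) _; exact: countableP.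
Qed.

(* Multiple edges and loops are allowed; the two ends of an edge are listed in
   an arbitrary order. *)
Record multigraph := Multigraph {
  vertex : choiceType;
  edge : choiceType;
  ends : edge -> vertex * vertex
}.

(* One edge joining g and g * s for each (g, s) in G x S; in particular an
   involution s gives two parallel edges between g and g * s. *)
Definition cayley (G : groupType) (S : {fset G}) : multigraph :=
  @Multigraph G (G * S)%type (fun e => (e.1, (e.1 * val e.2)%g)).

(* A configuration maps an edge to true when it is open; configurations carry
   the product sigma-algebra. *)
Definition open_event {E : Type} (e : E) : set (E -> bool) := [set w | w e].
Definition config (E : Type) := g_sigma_algebraType (range (@open_event E)).

Definition is_percolation_measure {R : realType} {E : choiceType} (p : R)
    (P : probability (config E) R) : Prop :=
  forall (F : {fset E}) (s : E -> bool),
    P [set w : config E | forall e, e \in F -> w e = s e] =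
    (\prod_(e <- F) bernoulli_pmf p (s e))%:E.

(* Existence of the product measure on countably many edges: the edge numbered
   n is open when the n-th digit of a uniform point x of [0, 1[ is true, where
   the first digit is x < p and the remaining ones are those of x rescaled. *)
Section Existence.
Context {R : realType} (p : R).
Hypothesis p01 : 0 <= p <= 1.

Let step (x : R) : R := if x < p then x / p else (x - p) / (1 - p).
Let digit (x : R) (n : nat) : bool := iter n step x < p.
Let I01 : set R := `[0, 1[%classic.

Let cyl n (J : pred nat) (s : nat -> bool) : set R :=
  [set x | forall i, (i < n)%N -> J i -> digit x i = s i].

Let digitS x n : digit x n.+1 = digit (step x) n.
Proof. by rewrite /digit iterSr. Qed.

Let full_cyl n s : exists a : R,
  cyl n predT s `&` I01 = `[a, a + \prod_(i < n) bernoulli_pmf p (s i)[%classic.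
Proof.
have itvE (a b x : R) : (`[a, b[%classic : set R) x = (a <= x < b) :> Prop.
  by rewrite set_itvE.
have cylIE m s' x : (cyl m predT s' `&` I01) x = (cyl m predT s' x /\ 0 <= x < 1).
  by rewrite -itvE.
elim: n s => [|n IH] s.
  exists 0; rewrite big_ord0 add0r.
  by apply/seteqP; split => x //= [].
have [a ha] := IH (s \o S).
rewrite big_ord_recl /=.
set l := \prod_(i < n) _ in ha; set l' := \prod_(i < n) _.
have -> : l' = l by [].
have inI x : (a <= x < a + l) -> 0 <= x < 1.
  move=> hx; have : (`[a, a + l[%classic : set R) x by rewrite itvE.
  by rewrite -ha cylIE => -[].
have inC x : (a <= x < a + l) <-> (cyl n predT (s \o S) x /\ 0 <= x < 1).
  have := congr1 (fun A : set R => A x) ha.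
  by rewrite cylIE itvE => <-.
have cylS x : cyl n.+1 predT s x <-> digit x 0 = s 0%N /\ cyl n predT (s \o S) (step x).
  split=> [h|[h0 h] [|i] // hi _]; first split.
  - exact: h.
  - by move=> i hi _; rewrite -digitS; exact: h.
  - by rewrite digitS; exact: h.
case/andP: p01 => p0 p1.
case s0: (s 0%N) => /=; rewrite /bernoulli_pmf /= ?s0.
- have [pe|pne] := eqVneq p 0.
    exists 0; rewrite pe mul0r addr0 set_itvco0.
    apply/seteqP; split => x //; rewrite cylIE => -[/cylS[h _]] /andP[x0 _].
    by move: h; rewrite s0 /digit /= pe ltNge x0.
  have pp : 0 < p by rewrite lt_def pne.
  exists (p * a); rewrite -mulrDr.
  have key x : p * a <= x < p * (a + l) <-> a <= x / p < a + l.
    by rewrite ler_pdivlMr // ltr_pdivrMr // ![p * _]mulrC.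
  apply/seteqP; split => x; rewrite cylIE itvE.
    move=> [/cylS[]]; rewrite s0 /digit /step /= => xp; rewrite xp => hc /andP[x0 x1].
    apply/key/inC; split => //; rewrite divr_ge0 //= ltr_pdivrMr // mul1r //.
  move/key => h; have /andP[h0 h1] := inI _ h.
  have xp : x < p by move: h1; rewrite ltr_pdivrMr // mul1r.
  have x0 : 0 <= x by move: h0; rewrite pmulr_lge0 // invr_gt0.
  split; last by rewrite x0 (lt_le_trans xp).
  by apply/cylS; rewrite s0 /digit /step /= xp; split => //; case/inC: h.
- have [pe|pne] := eqVneq p 1.
    exists 0; rewrite pe subrr mul0r addr0 set_itvco0.
    apply/seteqP; split => x //; rewrite cylIE => -[/cylS[h _]] /andP[_ x1].
    by move: h; rewrite s0 /digit /= pe x1.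
  have pp : 0 < 1 - p by rewrite subr_gt0 lt_def eq_sym pne.
  exists (p + (1 - p) * a); rewrite -addrA -mulrDr.
  have key x : p + (1 - p) * a <= x < p + (1 - p) * (a + l) <->
      a <= (x - p) / (1 - p) < a + l.
    by rewrite ler_pdivlMr // ltr_pdivrMr // lerBrDl ltrBlDl ![(1 - p) * _]mulrC.
  apply/seteqP; split => x; rewrite cylIE itvE.
    move=> [/cylS[]]; rewrite s0 /digit /step /= => xp; rewrite xp => hc /andP[x0 x1].
    apply/key/inC; split => //.
    apply/andP; split; last by rewrite ltr_pdivrMr // mul1r; lra.
    by apply: divr_ge0; [rewrite subr_ge0 leNgt xp | exact: ltW].
  move/key => h; have /andP[h0 h1] := inI _ h.
  have xp : (x < p) = false.
    by apply/negP/negP; rewrite -leNgt; move: h0; rewrite pmulr_lge0 ?invr_gt0 // subr_ge0.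
  have x1 : x < 1 by move: h1; rewrite ltr_pdivrMr // mul1r; lra.
  split; last by rewrite x1 andbT (le_trans p0) // leNgt xp.
  by apply/cylS; rewrite s0 /digit /step /= xp; split => //; case/inC: h.
Qed.

Let mdigit n : measurable_fun setT (fun x : measurableTypeR R => digit x n).
Proof.
apply: measurable_fun_ltr => //.
elim: n => [|n IH] /=; first exact: measurable_id.
suff mstep : measurable_fun setT (step : measurableTypeR R -> measurableTypeR R).
  exact: (measurableT_comp mstep IH).
apply: measurable_fun_ifT.
- exact: measurable_fun_ltr.
- exact: measurable_funM.
- by apply: measurable_funM => //; apply: measurable_funB.
Qed.

Let mdig n b : measurable [set x : measurableTypeR R | digit x n = b].
Proof.
have mb : measurable [set b] by [].
by have := mdigit n measurableT mb; rewrite setTI.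
Qed.

Let mcyl n J s : measurable (cyl n J s : set (measurableTypeR R)).
Proof.
have -> : cyl n J s =
    \bigcap_(i in [set i | (i < n)%N /\ J i]) [set x | digit x i = s i].
  apply/seteqP; split => x h i /=; first by case=> ? ?; apply: h.
  by move=> ? ?; apply: h.
by apply: bigcap_measurableType => // i _; exact: mdig.
Qed.

Let lam : {measure set (measurableTypeR R) -> \bar R} :=
  mrestr (@lebesgue_measure R) (measurable_itv `[0, 1[ : measurable I01).

Let lamU (A B : set (measurableTypeR R)) : measurable A -> measurable B ->
  A `&` B = set0 -> lam (A `|` B) = (lam A + lam B)%E.
Proof. exact: measureU. Qed.

Let lamT : lam setT = 1%E.
Proof.
by rewrite /lam /= /mrestr setTI /I01 lebesgue_measure_itv /= lte_fin ltr01 -EFinD subr0.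
Qed.

Let pmf_ge0 b : 0 <= bernoulli_pmf p b.
Proof. exact: bernoulli_pmf_ge0. Qed.

Let lam_cyl n J s :
  lam (cyl n J s) = (\prod_(i < n | J i) bernoulli_pmf p (s i))%:E.
Proof.
have [k] := ubnP (count (predC J) (iota 0 n)).
elim: k J s => // k IH J s; rewrite ltnS => hk.
have [hJ|] := boolP (all J (iota 0 n)).
  have J1 i : (i < n)%N -> J i by move=> hi; apply: (allP hJ); rewrite mem_iota.
  have -> : cyl n J s = cyl n predT s.
    by apply/seteqP; split => x h i hi _; apply: h => //; apply: J1.
  have [a ha] := full_cyl n s.
  rewrite /lam /= /mrestr ha lebesgue_measure_itv /= lte_fin.
  have -> : \prod_(i < n | J i) bernoulli_pmf p (s i) = \prod_(i < n) bernoulli_pmf p (s i).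
    by apply: eq_bigl => i; rewrite J1.
  have l0 : 0 <= \prod_(i < n) bernoulli_pmf p (s i) by apply: prodr_ge0.
  rewrite ltrDl; case: ifPn => h; first by rewrite -EFinD [a + _]addrC addrK.
  by congr EFin; apply/esym/eqP; rewrite -leNgt in h; rewrite eq_le h.
rewrite -has_predC => /hasP[j]; rewrite mem_iota add0n /= => jn Jj.
pose J' : pred nat := [pred i | (i == j) || J i].
pose s' b i := if i == j then b else s i.
have hk' : (count (predC J') (iota 0 n) < k)%N.
  apply: leq_trans hk.
  have -> : count (predC J) (iota 0 n) =
      (count (predC J') (iota 0 n) + count (pred1 j) (iota 0 n))%N.
    rewrite -count_predUI [X in (_ + X)%N](_ : _ = 0%N) ?addn0.
      apply: eq_count => i /=; rewrite negb_or.
      by case: eqVneq => [->|] /=; rewrite ?orbF ?Jj.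
    apply/eqP; rewrite -leqn0 leqNgt -has_count; apply/hasPn => i _ /=.
    by rewrite negb_or; case: eqVneq; rewrite ?andbF.
  by rewrite -[X in (X < _)%N]addn0 ltn_add2l -has_count; apply/hasP; exists j => /=; rewrite ?mem_iota.
have split_cyl : cyl n J s = cyl n J' (s' true) `|` cyl n J' (s' false).
  apply/seteqP; split => x /=.
    move=> h; case E: (digit x j); [left|right] => i hi /=;
      rewrite /J' /s' /=; case: eqVneq => [->|_] //=; exact: (h _ hi).
  by case=> h i hi Ji; have := h i hi; rewrite /J' /= Ji orbT /s' => /(_ isT) ->;
    case: eqVneq Jj => // <-; rewrite Ji.
have prodJ b : \prod_(i < n | J' i) bernoulli_pmf p (s' b i) =
    bernoulli_pmf p b * \prod_(i < n | J i) bernoulli_pmf p (s i).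
  rewrite (bigD1 (Ordinal jn)) /J' /s' /= ?eqxx //; congr (_ * _).
  apply: eq_big => i.
    by rewrite -val_eqE /=; case: eqVneq => [->|_] /=; rewrite ?andbT ?(negbTE Jj).
  by rewrite -val_eqE /= => /andP[_ /negbTE ->].
rewrite split_cyl lamU; [|exact: mcyl|exact: mcyl|].
  rewrite !IH // !prodJ -EFinD -mulrDl /bernoulli_pmf.
  by rewrite addrC subrK mul1r.
apply/seteqP; split => x //= [h1 h2].
have := h1 j jn; have := h2 j jn; rewrite /J' /s' /= !eqxx => /(_ isT) ->.
by move/(_ isT).
Qed.


Lemma percolation_measure_exists (E : choiceType) :
  countable [set: E] -> exists P, @is_percolation_measure R E p P.
Proof.
move=> /countable_injP[g ginj].
have {}ginj : injective g by move=> a b; apply: ginj; rewrite inE.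
pose D (x : measurableTypeR R) : config E := fun e => digit x (g e).
have mD : measurable_fun setT D.
  apply: (@measurability _ _ (measurableTypeR R) (config E) setT D (range (@open_event E)) erefl).
  move=> _ [_ [e _ <-] <-]; rewrite setTI; exact: (mdig (g e) true).
have [P0 P0E] : exists P0 : {measure set (config E) -> \bar R},
    forall A, P0 A = lam (D @^-1` A).
  pose P1 : {measure set (config E) -> \bar R} := pushforward lam D.
  by exists (P1 mD).
have P0T : P0 setT = 1%E by rewrite P0E preimage_setT lamT.
pose P : probability (config E) R := mnormalize P0 point.
have PE A : P A = lam (D @^-1` A).
  by rewrite -P0E /P /= /mnormalize P0T onee_eq0 /= invr1 mule1.
exists P => F s.
pose t := [seq g e | e <- F]; pose n := (\max_(i <- t) i).+1.
pose s' i := has (fun e => (g e == i) && s e) F.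
have s'E e : e \in F -> s' (g e) = s e.
  move=> eF; apply/hasP/idP => [[e' _ /andP[/eqP/ginj-> //]]|se].
  by exists e; rewrite ?eqxx.
have tn i : i \in t -> (i < n)%N.
  by move=> it; rewrite /n ltnS; exact: (@leq_bigmax_seq _ t predT id i it isT).
transitivity (lam (cyl n (mem t) s')).
  rewrite PE; congr (lam _); apply/seteqP; split => x /= h.
    by move=> i _ /mapP[e eF ->]; rewrite s'E //; exact: h.
  move=> e eF; rewrite -(s'E e eF); have gt : g e \in t by exact: map_f.
  by apply: h => //; exact: tn.
rewrite lam_cyl; congr EFin.
rewrite -(big_mkord (fun i => i \in t) (fun i => bernoulli_pmf p (s' i))).
rewrite -big_filter (perm_big t).
  by rewrite big_map; apply: eq_big_seq => e eF; rewrite s'E.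
apply: uniq_perm; first by rewrite filter_uniq // iota_uniq.
  by rewrite map_inj_uniq // fset_uniq.
move=> i; rewrite mem_filter mem_iota /= add0n subn0.
by case it: (i \in t) => //=; rewrite tn.
Qed.
End Existence.

(* The product measure exists as soon as E is countable, by
   percolation_measure_exists, and is unique since cylinders form a pi-system
   generating the sigma-algebra. *)
Definition percolation {R : realType} (E : choiceType) (p : R) :
    probability (config E) R :=
  get (@is_percolation_measure R E p).

Lemma percolationP {R : realType} (E : choiceType) (p : R) :
  0 <= p <= 1 -> countable [set: E] -> is_percolation_measure p (percolation E p).
Proof. by move=> p01 cE; have [P] := percolation_measure_exists p01 cE; exact: getI. Qed.

Lemma percolation_cayleyP {R : realType} (G : groupType) (S : {fset G}) (p : R) :
  0 <= p <= 1 -> generates S ->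
  is_percolation_measure p (percolation (edge (cayley S)) p).
Proof.
move=> p01 /generates_countable cG; apply: percolationP => //.
by rewrite -setXTT; apply: countableX => //; exact: countableP.
Qed.

Definition open_adj (X : multigraph) (w : config (edge X)) (x y : vertex X) : Prop :=
  exists e : edge X, w e /\ (ends e = (x, y) \/ ends e = (y, x)).

Definition cluster (X : multigraph) (w : config (edge X)) (o : vertex X) :
    set (vertex X) :=
  [set x | clos_refl_trans (vertex X) (open_adj w) o x].

Definition theta {R : realType} (X : multigraph) (o : vertex X) (p : R) : \bar R :=
  percolation (edge X) p [set w | infinite_set (cluster w o)].

Definition critical_probability {R : realType} (X : multigraph) (o : vertex X) : R :=
  inf [set p : R | 0 <= p <= 1 /\ (0 < theta o p)%E].

(* counting A is the number of elements of A, +oo when A is infinite. *)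
Definition expected_cluster_size {R : realType} (X : multigraph) (o : vertex X)
    (p : R) : \bar R :=
  (\int[percolation (edge X) p]_w counting (cluster w o))%E.

Definition chi {R : realType} (G : groupType) (S : {fset G}) (p : R) : \bar R :=
  @expected_cluster_size R (cayley S) 1%g p.

Definition cayley_pc {R : realType} (G : groupType) (S : {fset G}) : R :=
  @critical_probability R (cayley S) 1%g.

(* Main.v *)
From mathcomp Require Import all_boot all_order all_algebra finmap.
From mathcomp Require Import all_classical all_reals all_analysis.
From mathcomp Require Import measurable_realfun ring lra.
From Stdlib Require Import Relation_Operators.
Require Import Defs.
Set Implicit Arguments.
Unset Strict Implicit.
Unset Printing Implicit Defensive.
Import Order.TTheory GRing.Theory Num.Theory.
Import numFieldNormedType.Exports.
Local Open Scope classical_set_scope.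
Local Open Scope ring_scope.

(* A path from the identity to a reduced word x1 ... xn runs through the prefixes
   x1, x1 x2, ..., which are cut vertices, so the probability that it is open is the
   product of the two-point functions of the letters in the factors. With
   a = chi_1 - 1 and b = chi_2 - 1, the expected cluster size is thus a sum over
   alternating words, finite iff a b < 1. If a b > 1, the words with letters in
   suitable finite sets form a supercritical two-type branching structure: the
   probability s_n of reaching level n satisfies, by Bonferroni,
   s_(n+1) >= alpha s_n - K s_n^2, so it does not tend to 0 and theta > 0.
   The two conditions a b < 1 and a b > 1 are open to the right, respectively to the
   left: a finite expected cluster size remains finite for slightly larger p
   (exploration to a depth n with expected frontier size less than 1), and a, b are
   suprema of probabilities of local events. Hence a b = 1 at p_c, and a b is strictly
   increasing, as all edges at the origin may be closed by thinning. *)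

(** * Bernoulli product measures and couplings *)

(** Openness to the right is the delicate half: chi is a supremum of probabilities of local events,
    hence lower semicontinuous for free, but a finite value could a priori jump to infinity just
    above p. This is why finiteness is traced to a condition on a single finite ball.

    Parameters are compared by thinning only: the pointwise conjunction of independent
    configurations of parameters p and q has parameter p q. No derivative in p is taken.

    The endpoints enter as follows. At p = 0 both a and b vanish, so openness to the right gives p_c
    > 0. At p = 1 each vertex is almost surely connected to the origin, so the infimum is over a
    nonempty set; moreover a, b >= 1 there, so a b < 1 at p_c would force p_c < 1 and leave room on
    the right.

    The numbers a and b may be infinite, but they are positive for p > 0, so an infinite one makes a
    b infinite, and a b <= 1 forces both to be finite. Estimates are made on sums over finite
    duplicate-free lists, with bounds independent of the list. *)

Lemma exprn_onem_ge (R : realDomainType) n (x : R) : 0 <= x <= 1 ->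
  1 - n%:R * x <= (1 - x) ^+ n.
Proof.
case/andP=> x0 x1; elim: n => [|n IH]; first by rewrite mul0r subr0.
by rewrite exprS -natr1; have : 0 <= n%:R :> R by []; nra.
Qed.

Section Percolation.
Context {R : realType}.
Implicit Types (E : choiceType) (p q : R).

Definition Pr {E} p (A : set (config E)) : R := fine (percolation E p A).

Lemma PrE E p (A : set (config E)) : measurable A ->
  percolation E p A = (Pr p A)%:E.
Proof. by move=> mA; rewrite /Pr fineK // fin_num_measure. Qed.

Lemma Pr_ge0 E p (A : set (config E)) : 0 <= Pr p A.
Proof. exact/fine_ge0/measure_ge0. Qed.

Lemma le_Pr E p (A B : set (config E)) : measurable A -> measurable B ->
  A `<=` B -> Pr p A <= Pr p B.
Proof.
by move=> mA mB AB; rewrite -lee_fin -!PrE //; apply: le_measure; rewrite ?inE.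
Qed.

Lemma PrT E p : Pr p [set: config E] = 1.
Proof. by rewrite /Pr probability_setT. Qed.

Lemma Pr_le1 E p (A : set (config E)) : measurable A -> Pr p A <= 1.
Proof. by move=> mA; rewrite -(PrT E p); apply: le_Pr. Qed.

Lemma PrC E p (A : set (config E)) : measurable A -> Pr p (~` A) = 1 - Pr p A.
Proof.
by move=> mA; apply: EFin_inj; rewrite -PrE ?probability_setC ?PrE //; exact: measurableC.
Qed.

Lemma PrUI E p (A B : set (config E)) : measurable A -> measurable B ->
  Pr p (A `|` B) = Pr p A + Pr p B - Pr p (A `&` B).
Proof.
move=> mA mB; have mU := measurableU _ _ mA mB; have mI := measurableI _ _ mA mB.
apply: EFin_inj; rewrite -PrE // measureUfinr -?ge0_fin_numE ?fin_num_measure //.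
by rewrite EFinB EFinD -!PrE.
Qed.

Lemma PrU_disjoint E p (A B : set (config E)) : measurable A -> measurable B ->
  A `&` B = set0 -> Pr p (A `|` B) = Pr p A + Pr p B.
Proof. by move=> mA mB AB0; rewrite PrUI // AB0 /Pr measure0 subr0. Qed.

Lemma PrU_le E p (A B : set (config E)) : measurable A -> measurable B ->
  Pr p (A `|` B) <= Pr p A + Pr p B.
Proof. by move=> mA mB; rewrite PrUI // lerBlDr lerDl Pr_ge0. Qed.

(** * Finite unions of events and Bonferroni's inequality *)

Definition some_of {I : eqType} {T : Type} (r : seq I) (A : I -> set T) : set T :=
  [set w | exists2 i, i \in r & A i w].

Lemma some_of_nil (I : eqType) T (A : I -> set T) : some_of [::] A = set0.
Proof. by apply/seteqP; split => // w []. Qed.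

Lemma some_of_cons (I : eqType) T i (r : seq I) (A : I -> set T) :
  some_of (i :: r) A = A i `|` some_of r A.
Proof.
apply/seteqP; split => w.
  by case=> j; rewrite inE => /predU1P[->|jr] Aj; [left|right; exists j].
by case=> [Ai|[j jr Aj]]; [exists i; rewrite ?mem_head|exists j; rewrite // inE jr orbT].
Qed.

Lemma measurable_some_of E (I : eqType) (r : seq I) (A : I -> set (config E)) :
  (forall i, measurable (A i)) -> measurable (some_of r A).
Proof.
move=> mA; elim: r => [|i r IH]; first by rewrite some_of_nil.
by rewrite some_of_cons; exact: measurableU.
Qed.

Lemma Pr_some_of_le E p (I : eqType) (r : seq I) (A : I -> set (config E)) :
  (forall i, measurable (A i)) -> Pr p (some_of r A) <= \sum_(i <- r) Pr p (A i).
Proof.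
move=> mA; elim: r => [|i r IH]; first by rewrite big_nil some_of_nil /Pr measure0.
rewrite big_cons some_of_cons.
apply: (le_trans (PrU_le _ _ _)) => //; first exact: measurable_some_of.
by rewrite lerD2l.
Qed.

Lemma Pr_disjoint_le E p (I : eqType) (r : seq I) (A : I -> set (config E))
    (B : set (config E)) : (forall i, measurable (A i)) -> measurable B -> uniq r ->
  (forall i j, i != j -> A i `&` A j = set0) -> (forall i, A i `<=` B) ->
  \sum_(i <- r) Pr p (A i) <= Pr p B.
Proof.
move=> mA mB ur dA AB; have mU s := measurable_some_of s mA.
suff <- : Pr p (some_of r A) = \sum_(i <- r) Pr p (A i).
  by apply: le_Pr => // w [i _ Ai]; apply: AB Ai.
elim: r ur => [|i r IH] /=; first by rewrite big_nil some_of_nil /Pr measure0.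
case/andP=> ir ur; rewrite big_cons some_of_cons PrU_disjoint ?IH //.
apply/seteqP; split => // w [Ai [j jr Aj]].
have ij : i != j by apply: contraNneq ir => ->.
by rewrite -(dA i j ij).
Qed.

(** Adding one event to a list of n loses at most n t in overlaps, and n^2 + n <= (n + 1)^2. The
    crude square is enough because t will be the square of a small probability. *)
Lemma Bonferroni_ge E p (I : eqType) (r : seq I) (A : I -> set (config E)) (t : R) :
  (forall i, measurable (A i)) -> uniq r -> 0 <= t ->
  (forall i j, i \in r -> j \in r -> i != j -> Pr p (A i `&` A j) <= t) ->
  \sum_(i <- r) Pr p (A i) - (size r)%:R ^+ 2 * t <= Pr p (some_of r A).
Proof.
move=> mA ur t0 hr; have mU s := measurable_some_of s mA.
elim: r ur hr => [|i r IH] /=.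
  by rewrite big_nil some_of_nil /Pr measure0 expr0n mul0r subr0.
case/andP=> ir ur hr.
have {}IH := IH ur (fun j k jr kr => hr j k (mem_behead (s := i :: r) jr)
  (mem_behead (s := i :: r) kr)).
rewrite big_cons some_of_cons PrUI //.
have hI : Pr p (A i `&` some_of r A) <= (size r)%:R * t.
  rewrite (_ : _ `&` _ = some_of r (fun j => A i `&` A j)); last first.
    apply/seteqP; split => w; first by case=> Ai [j jr Aj]; exists j.
    by case=> j jr [Ai Aj]; split => //; exists j.
  apply: (le_trans (Pr_some_of_le _ _ _)) => [j|]; first exact: measurableI.
  rewrite (_ : _ * t = \sum_(j <- r) t); last first.
    by rewrite big_const_seq count_predT iter_addr_0 mulr_natl.
  rewrite big_seq [leRHS]big_seq; apply: ler_sum => j jr;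
    apply: hr; rewrite ?inE ?eqxx ?jr ?orbT //.
  by apply: contraNneq ir => ->.
by have : 0 <= (size r)%:R :> R by []; rewrite -natr1; nra.
Qed.

Lemma measurable_open E (e : E) : measurable (open_event e : set (config E)).
Proof. by apply: sub_sigma_algebra; exists e. Qed.

Lemma measurable_cylinder E (F : seq E) :
  measurable [set w : config E | {in F, forall e, w e}].
Proof.
elim: F => [|e F IH].
  by rewrite (_ : [set w | _] = setT) //; apply/seteqP; split => // w _ e.
rewrite (_ : [set w | _] = open_event e `&` [set w | {in F, forall e, w e}]).
  by apply: measurableI IH; exact: measurable_open.
apply/seteqP; split => w.
  move=> h; split; first by apply: h; rewrite mem_head.
  by move=> f fF; apply: h; rewrite inE fF orbT.
by case=> we h f; rewrite inE => /predU1P[->|/h].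
Qed.

Lemma measurable_config d (T : measurableType d) E (f : T -> config E) :
  (forall e, measurable [set x | f x e]) -> measurable_fun setT f.
Proof.
move=> mf.
apply: (@measurability _ _ T (config E) setT f (range (@open_event E)) erefl).
by move=> _ [_ [e _ <-] <-]; rewrite setTI; exact: mf.
Qed.

Lemma measurable_preim d d' (T : measurableType d) (T' : measurableType d')
  (f : T -> T') (A : set T') : measurable_fun setT f -> measurable A ->
  measurable [set x | A (f x)].
Proof. by move=> mf mA; have := mf measurableT A mA; rewrite setTI. Qed.

(** * Laws of transformed configurations: independence, thinning, exchange of open and closed
    edges *)

Section Uniqueness.
Variables (E : choiceType) (cE : countable [set: E]).

Lemma Pr_cylinder p (F : seq E) : 0 <= p <= 1 -> uniq F ->
  Pr p [set w : config E | {in F, forall e, w e}] = p ^+ size F.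
Proof.
move=> p01 uF; have := percolationP p01 cE [fset e in F]%fset xpredT.
rewrite (perm_big F) /=; last by apply: uniq_perm => // e; rewrite inE.
have -> : [set w : config E | forall e, e \in [fset e in F]%fset -> w e = true] =
    [set w : config E | {in F, forall e, w e}].
  by apply/seteqP; split => w /= h e eF; apply: h; move: eF; rewrite !inE.
rewrite PrE; last exact: measurable_cylinder.
rewrite /bernoulli_pmf /= => -[->].
by rewrite big_const_seq count_predT -Monoid.iteropE.
Qed.

(* Open cylinders form a pi-system generating the sigma-algebra. *)
Lemma percolation_unique p (mu : {measure set (config E) -> \bar R}) :
  0 <= p <= 1 ->
  (forall F : seq E, uniq F ->
    mu [set w : config E | {in F, forall e, w e}] = (p ^+ size F)%:E) ->
  forall A, measurable A -> mu A = (Pr p A)%:E.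
Proof.
move=> p01 hmu A mA; rewrite -PrE //.
pose G := [set A | exists F : {fset E},
  A = [set w : config E | {in F, forall e, w e}]].
have GT : G setT.
  by exists fset0; apply/seteqP; split => // w _ e; rewrite inE.
apply: (@measure_unique _ _ (config E) G (fun=> setT)) => //.
- apply/seteqP; split.
    apply: smallest_sub; first exact: smallest_sigma_algebra.
    move=> _ [e _ <-]; apply: sub_sigma_algebra; exists [fset e]%fset.
    apply/seteqP; split => w /=; first by move=> we f; rewrite inE => /eqP ->.
    by apply; rewrite inE.
  apply: smallest_sub; first exact: sigma_algebra_measurable.
  by move=> _ [F ->]; exact: measurable_cylinder.
- move=> _ _ [F ->] [F' ->]; exists (F `|` F')%fset; apply/seteqP; split => w /=.
    by case=> h h' e; rewrite inE => /orP[/h|/h'].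
  by move=> h; split => e eF; apply: h; rewrite inE eF ?orbT.
- by rewrite bigcup_const.
- move=> _ [F ->]; rewrite hmu ?fset_uniq // -Pr_cylinder ?fset_uniq //.
  by apply/esym/PrE; exact: measurable_cylinder.
- move=> _; rewrite (_ : setT = [set w : config E | {in [::], forall e, w e}]).
    by rewrite hmu // ltry.
  by apply/seteqP; split.
Qed.

(** Open cylinders suffice to recognize the law of a random configuration [f]. Every coupling below
    is an instance, with [f] a mixture, a conjunction, a negation or a restriction. *)
Lemma percolation_law p d (T : measurableType d) (mu : {measure set T -> \bar R})
    (f : T -> config E) : 0 <= p <= 1 -> measurable_fun setT f ->
  (forall F : seq E, uniq F ->
    mu [set x | {in F, forall e, f x e}] = (p ^+ size F)%:E) ->
  forall A, measurable A -> mu [set x | A (f x)] = (Pr p A)%:E.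
Proof.
move=> p01 mf hmu A mA.
have [nu nuE] : exists nu : {measure set (config E) -> \bar R},
    forall A, nu A = mu (f @^-1` A).
  pose nu : {measure set (config E) -> \bar R} := pushforward mu f.
  by exists (nu mf).
transitivity (nu A); first by rewrite nuE.
by apply: percolation_unique => // F uF; rewrite nuE; exact: hmu.
Qed.

Definition Pr2 p q : {measure set (config E * config E) -> \bar R} :=
  (percolation E p \x percolation E q)%E.

Lemma Pr2E p q (A B : set (config E)) : measurable A -> measurable B ->
  Pr2 p q (A `*` B) = (Pr p A * Pr q B)%:E.
Proof.
by move=> mA mB; rewrite EFinM -!PrE //; exact: product_measure1E.
Qed.

Definition depends_on (D : E -> Prop) (A : set (config E)) :=
  forall w w' : config E, (forall e, D e -> w e = w' e) -> A w -> A w'.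

(** Reading the edges of [D] in one of two independent configurations and all others in the second
    gives the percolation law again, and under this mixture the intersection becomes a rectangle. *)
Lemma Pr_indep p (D D' : E -> Prop) (A B : set (config E)) : 0 <= p <= 1 ->
  measurable A -> measurable B -> depends_on D A -> depends_on D' B ->
  (forall e, D e -> D' e -> False) -> Pr p (A `&` B) = Pr p A * Pr p B.
Proof.
move=> p01 mA mB dA dB DD'.
pose mix (x : config E * config E) : config E :=
  fun e => if `[< D e >] then x.1 e else x.2 e.
have mmix : measurable_fun setT mix.
  apply: measurable_config => e; rewrite /mix; case: `[< _ >].
    exact: (measurable_preim measurable_fst (measurable_open e)).
  exact: (measurable_preim measurable_snd (measurable_open e)).
have mAB := measurableI _ _ mA mB.
have h := @percolation_law p _ _ (Pr2 p p) mix p01 mmix _ _ mAB.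
apply: EFin_inj; rewrite -{}h.
  rewrite -Pr2E //; congr (Pr2 p p _); apply/seteqP; split => -[u v] /=.
    case=> hA hB; split.
      by apply: dA hA => e De; rewrite /mix asboolT.
    by apply: dB hB => e De; rewrite /mix asboolF // => /DD'; apply.
  case=> hA hB; split.
    by apply: dA hA => e De; rewrite /mix asboolT.
  by apply: dB hB => e De; rewrite /mix asboolF // => /DD'; apply.
move=> F uF.
rewrite (_ : [set x | _] =
  [set w : config E | {in [seq e <- F | `[< D e >]], forall e, w e}] `*`
  [set w : config E | {in [seq e <- F | ~~ `[< D e >]], forall e, w e}]).
  rewrite Pr2E; [|exact: measurable_cylinder..].
  rewrite !Pr_cylinder ?filter_uniq // -exprD !size_filter.
  by rewrite (count_predC (fun e => `[< D e >])).
rewrite /mix; apply/seteqP; split => -[u v] /=.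
  move=> h; split => e; rewrite mem_filter => /andP[De eF]; have := h e eF.
    by rewrite De.
  by rewrite (negPf De).
case=> h h' e eF; case: ifPn => De; first by apply: h; rewrite mem_filter De.
by apply: h'; rewrite mem_filter De.
Qed.

Definition thin (x : config E * config E) : config E := fun e => x.1 e && x.2 e.

Lemma measurable_thin : measurable_fun setT thin.
Proof.
apply: measurable_config => e.
rewrite (_ : [set x | _] = (open_event e : set (config E)) `*` open_event e).
  by apply: measurableX; exact: measurable_open.
by apply/seteqP; split => -[u v] /= => [/andP[]|[uv vv]]; last apply/andP.
Qed.

Lemma Pr_thin p q (A : set (config E)) : 0 <= p <= 1 -> 0 <= q <= 1 ->
  measurable A -> (Pr (p * q) A)%:E = Pr2 p q [set x | A (thin x)].
Proof.
move=> p01 q01 mA; symmetry; apply: percolation_law mA; last 2 first.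
- exact: measurable_thin.
- move=> F uF; rewrite (_ : [set x | _] = [set w : config E | {in F, forall e, w e}] `*`
    [set w : config E | {in F, forall e, w e}]).
    by rewrite Pr2E ?Pr_cylinder ?exprMn //; exact: measurable_cylinder.
  apply/seteqP; split => -[u v] /=.
    by move=> h; split => e /h /andP[].
  by case=> h h' e eF; apply/andP; split; [apply: h|apply: h'].
- by case/andP: p01 q01 => p0 p1 /andP[q0 q1]; rewrite mulr_ge0 // mulr_ile1.
Qed.

Lemma measurable_thin_preim (A : set (config E)) : measurable A ->
  measurable [set x | A (thin x)].
Proof. exact: measurable_preim measurable_thin. Qed.

Lemma le_Pr2 p q (A B : set (config E * config E)) : measurable A -> measurable B ->
  A `<=` B -> (Pr2 p q A <= Pr2 p q B)%E.
Proof. by move=> mA mB AB; apply: le_measure; rewrite ?inE. Qed.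

Definition increasing (A : set (config E)) :=
  forall w w' : config E, (forall e, w e -> w' e) -> A w -> A w'.

Lemma Pr_thin_le p q (A : set (config E)) : 0 <= p <= 1 -> 0 <= q <= 1 ->
  measurable A -> increasing A -> Pr (p * q) A <= Pr p A.
Proof.
move=> p01 q01 mA iA; rewrite -lee_fin Pr_thin // -[Pr p A]mulr1 -(PrT E q) -Pr2E //.
apply: le_Pr2; [exact: measurable_thin_preim|exact: measurableX|].
by move=> [u v] /= Auv; split => //; apply: iA Auv => e /andP[].
Qed.

(** For [p' > 0], parameter [p] is the thinning of parameter [p'] by [p / p']. *)
Lemma Pr_increasing p p' (A : set (config E)) : 0 <= p -> p <= p' -> p' <= 1 ->
  measurable A -> increasing A -> Pr p A <= Pr p' A.
Proof.
move=> p0 pp' p'1 mA iA.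
have [p'0|p'N0] := eqVneq p' 0; first by rewrite (_ : p = p') //; lra.
have p'0 : 0 < p' by rewrite lt_def p'N0 (le_trans p0).
rewrite (_ : p = p' * (p / p')); last by rewrite mulrC divfK.
apply: Pr_thin_le => //; first by rewrite p'1 ltW.
by rewrite divr_ge0 // ?ler_pdivrMr ?mul1r // ltW.
Qed.

(** When the second configuration is open on all of [F], thinning changes nothing on [F], where [A]
    is decided. *)
Lemma Pr_thin_local p q (F : seq E) (A : set (config E)) : 0 <= p <= 1 ->
  0 <= q <= 1 -> measurable A -> uniq F -> depends_on [set` F] A ->
  Pr p A * q ^+ size F <= Pr (p * q) A.
Proof.
move=> p01 q01 mA uF dA; rewrite -lee_fin Pr_thin // -Pr_cylinder //.
have mF := measurable_cylinder F; rewrite -Pr2E //.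
apply: le_Pr2; [exact: measurableX|exact: measurable_thin_preim|].
move=> [u v] /= [Au hv]; apply: dA Au => e eF.
by rewrite /thin /= hv // andbT.
Qed.

Definition flip (w : config E) : config E := fun e => ~~ w e.

Lemma measurable_flip : measurable_fun setT flip.
Proof.
apply: measurable_config => e; rewrite (_ : [set x | _] = ~` open_event e).
  by apply: measurableC; exact: measurable_open.
by apply/seteqP; split => w /=; [move/negP|move/negP].
Qed.

Lemma Pr_closed p (F : seq E) : 0 <= p <= 1 -> uniq F ->
  Pr p [set w : config E | {in F, forall e, ~~ w e}] = (1 - p) ^+ size F.
Proof.
move=> p01 uF; have := percolationP p01 cE [fset e in F]%fset (fun=> false).
rewrite (perm_big F) /=; last by apply: uniq_perm => // e; rewrite inE.
have mF := measurable_preim measurable_flip (measurable_cylinder F).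
have -> : [set w : config E | forall e, e \in [fset e in F]%fset -> w e = false] =
    [set w : config E | {in F, forall e, ~~ w e}].
  apply/seteqP; split => w /= h e eF; first by rewrite h ?inE.
  by apply: negPf; apply: h; move: eF; rewrite inE.
rewrite PrE //.
rewrite /bernoulli_pmf /= => -[->].
by rewrite big_const_seq count_predT -Monoid.iteropE.
Qed.

(* The thinned configuration is empty on F with probability at least (1-q)^|F|,
   independently of the original one. *)
Lemma Pr_thin_hit p q (F : seq E) (A : set (config E)) : 0 <= p <= 1 ->
  0 <= q <= 1 -> measurable A -> uniq F -> increasing A ->
  (forall w : config E, A w -> exists2 e, e \in F & w e) ->
  Pr (p * q) A <= Pr p A * (1 - (1 - q) ^+ size F).
Proof.
move=> p01 q01 mA uF iA hA; rewrite -lee_fin Pr_thin // -Pr_closed //.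
have mF := measurable_preim measurable_flip (measurable_cylinder F).
rewrite -PrC // -Pr2E //; last exact: measurableC.
apply: le_Pr2; [exact: measurable_thin_preim|by apply: measurableX => //; exact: measurableC|].
move=> [u v] /= Auv; split; first by apply: iA Auv => e /andP[].
by move=> h; have [e /h /negP h1 /andP[]] := hA _ Auv.
Qed.

Lemma Pr_flip p (A : set (config E)) : 0 <= p <= 1 -> measurable A ->
  Pr p [set w | A (flip w)] = Pr (1 - p) A.
Proof.
move=> p01 mA; apply: EFin_inj; rewrite -PrE; last first.
  exact: measurable_preim measurable_flip mA.
apply: (@percolation_law (1 - p) _ _ (percolation E p)) => //.
- by case/andP: p01 => p0 p1; rewrite subr_ge0 p1 lerBlDr lerDl.
- exact: measurable_flip.
move=> F uF; rewrite -Pr_closed // -PrE //.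
exact: (measurable_preim measurable_flip (measurable_cylinder F)).
Qed.

(* Apply Pr_thin_local to the complement of A after exchanging open and closed edges. *)
Lemma Pr_local_right p (F : seq E) (A : set (config E)) (eps : R) : 0 <= p <= 1 ->
  0 <= eps <= 1 -> measurable A -> uniq F -> depends_on [set` F] A ->
  Pr (p + (1 - p) * eps) A <= Pr p A + (size F)%:R * eps.
Proof.
move=> p01 e01 mA uF dA.
have p1 : 0 <= 1 - p <= 1 by lra.
have e1 : 0 <= 1 - eps <= 1 by lra.
have pe : 0 <= p + (1 - p) * eps <= 1 by nra.
have mC := measurableC mA; have mfC := measurable_preim measurable_flip mC.
have := @Pr_thin_local (1 - p) (1 - eps) F _ p1 e1 mfC uF.
have fl r : 0 <= r <= 1 -> Pr (1 - r) [set w | (~` A) (flip w)] = 1 - Pr r A.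
  by move=> r01; rewrite Pr_flip ?subKr ?PrC //; lra.
rewrite (_ : (1 - p) * (1 - eps) = 1 - (p + (1 - p) * eps)); last by ring.
rewrite !fl //.
have bern := exprn_onem_ge (size F) e01.
have := Pr_ge0 p A; have := Pr_le1 p mA; have := Pr_ge0 (p + (1 - p) * eps) A.
have e2 : (1 - eps) ^+ size F <= 1 by apply: exprn_ile1; lra.
have e3 : 0 <= (1 - eps) ^+ size F by apply: exprn_ge0; lra.
move=> h1 h2 h3 h.
have {h}h : (1 - Pr p A) * (1 - eps) ^+ size F <= 1 - Pr (p + (1 - p) * eps) A.
  apply: h => w w' ww' nA Aw'; apply: nA; apply: dA Aw' => e eF.
  by rewrite /flip ww'.
have : 0 <= Pr p A * (1 - (1 - eps) ^+ size F) by rewrite mulr_ge0 // subr_ge0.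
lra.
Qed.
End Uniqueness.

(** Used in two ways: with [phi] a translation of a Cayley graph, for invariance, and with [phi] the
    inclusion of the edges of a factor into those of the free product. *)
Lemma Pr_embed (E E' : choiceType) (cE : countable [set: E])
    (cE' : countable [set: E']) p (phi : E' -> E) (A : set (config E')) :
  0 <= p <= 1 -> injective phi -> measurable A ->
  Pr p [set w : config E | A (w \o phi)] = Pr p A.
Proof.
move=> p01 phiI mA.
have mf : measurable_fun setT (fun w : config E => (w \o phi : config E')).
  by apply: measurable_config => e; exact: measurable_open.
apply: EFin_inj; rewrite -PrE; last exact: measurable_preim mf mA.
apply: (@percolation_law _ cE' p _ _ (percolation E p)) => // F uF.
rewrite -(size_map phi) -(Pr_cylinder cE) // ?map_inj_uniq //.
rewrite -PrE; last exact: measurable_cylinder.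
congr (percolation E p _); apply/seteqP; split => w /=.
  by move=> h _ /mapP[e eF ->]; exact: h.
by move=> h e eF; apply: h; exact: map_f.
Qed.
End Percolation.

(** * Open paths of bounded length *)

Section Reach.
Variable X : multigraph.
Implicit Types (w : config (edge X)) (x y z : vertex X).

(** Paths of at most n steps. These approximate [cluster] from below by events that, in a locally
    finite graph, depend on finitely many edges. *)
Fixpoint reach w n x : set (vertex X) :=
  if n is m.+1 then [set y | reach w m x y \/ exists2 z, reach w m x z & open_adj w z y]
  else [set x].

Lemma open_adj_sym w x y : open_adj w x y -> open_adj w y x.
Proof. by case=> e [we [h|h]]; exists e; split=> //; [right|left]. Qed.

Lemma le_reach w m n x y : (m <= n)%N -> reach w m x y -> reach w n x y.
Proof.
move=> /subnK <-; elim: (n - m)%N => [//|k IH] h; rewrite addSn; left; exact: IH.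
Qed.

Lemma reach_refl w n x : reach w n x x.
Proof. exact: (@le_reach w 0). Qed.

Lemma reach_trans w m n x y z : reach w m x y -> reach w n y z -> reach w (m + n) x z.
Proof.
move=> hm; elim: n z => [|n IH] z /=; first by move=> ->; rewrite addn0.
rewrite addnS => -[/IH ?|[u /IH hu uz]]; first by left.
by right; exists u.
Qed.

Lemma clusterP w x y : cluster w x y <-> exists n, reach w n x y.
Proof.
split=> [|[n]].
  elim=> {x y} [x y xy|x|x y z _ [m hm] _ [n hn]].
  - by exists 1%N; right; exists x.
  - by exists 0%N.
  - by exists (m + n)%N; exact: reach_trans hm hn.
elim: n y => [|n IH] y /=; first by move=> ->; exact: rt_refl.
case=> [/IH //|[z /IH xz zy]].
by apply: (rt_trans _ _ _ _ _ xz); exact: rt_step.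
Qed.

Lemma cluster_sym w x y : cluster w x y -> cluster w y x.
Proof.
elim=> {x y} [x y xy|x|x y z _ yx _ zy].
- by apply: rt_step; exact: open_adj_sym.
- exact: rt_refl.
- exact: rt_trans zy yx.
Qed.

Lemma cluster_trans w x y z : cluster w x y -> cluster w y z -> cluster w x z.
Proof. exact: rt_trans. Qed.

Lemma increasing_reach n x y : increasing [set w | reach w n x y].
Proof.
move=> w w' ww'; elim: n y => [//|n IH] y /= [/IH ?|[z /IH hz [e [we h]]]].
  by left.
by right; exists z => //; exists e; split=> //; exact: ww'.
Qed.

Lemma increasing_cluster x y : increasing [set w | cluster w x y].
Proof.
move=> w w' ww' /clusterP[n h]; apply/clusterP; exists n.
exact: increasing_reach ww' h.
Qed.

Hypothesis cE : countable [set: edge X].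

Lemma measurable_reach n x y : measurable [set w | reach w n x y].
Proof.
elim: n y => [|n IH] y /=.
  have [->|xy] := pselect (y = x).
    by rewrite (_ : [set _ | _] = setT) //; apply/seteqP; split.
  by rewrite (_ : [set _ | _] = set0) //; apply/seteqP; split.
(* The last step uses an edge [e] whose other end [z] is one of its two ends, so a countable union
   over edges covers all cases. *)
pose B e z : set (config (edge X)) :=
  if `[< ends e = (z, y) \/ ends e = (y, z) >]
  then [set w | reach w n x z] `&` open_event e else set0.
have mB e z : measurable (B e z).
  by rewrite /B; case: ifP => // _; apply: measurableI; [exact: IH|exact: measurable_open].
rewrite (_ : [set _ | _] = [set w | reach w n x y] `|`
    \bigcup_e (B e (ends e).1 `|` B e (ends e).2)).
  apply: measurableU; first exact: IH.
  by apply: countable_bigcupT_measurable => // e; apply: measurableU.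
apply/seteqP; split => w /=.
  move=> [h|[z hz [e [we h]]]]; [by left|right]; exists e => //.
  by case: h => eq; [left|right]; rewrite /B eq /= asboolT //; [left|right].
case=> [h|[e _ [|]]]; [by left|..]; rewrite /B; case: asboolP => // h [hz we];
  by right; eexists; [exact: hz|exists e].
Qed.

Lemma cluster_bigcup x y :
  [set w | cluster w x y] = \bigcup_n [set w | reach w n x y].
Proof.
apply/seteqP; split => w /=; first by move/clusterP => [n]; exists n.
by case=> n _ h; apply/clusterP; exists n.
Qed.

Lemma measurable_cluster x y : measurable [set w | cluster w x y].
Proof.
by rewrite cluster_bigcup; apply: bigcupT_measurable => n; exact: measurable_reach.
Qed.

Definition tau {R : realType} (p : R) x y : R := Pr p [set w | cluster w x y].
Definition taun {R : realType} (p : R) n x y : R := Pr p [set w | reach w n x y].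

Lemma tau_ge0 {R : realType} (p : R) x y : 0 <= tau p x y.
Proof. exact: Pr_ge0. Qed.

Lemma tau_refl {R : realType} (p : R) x : tau p x x = 1.
Proof.
rewrite -(PrT (edge X) p); congr (Pr p _); apply/seteqP; split => // w _.
exact: rt_refl.
Qed.

Lemma taun_ge0 {R : realType} (p : R) n x y : 0 <= taun p n x y.
Proof. exact: Pr_ge0. Qed.

Lemma le_taun {R : realType} (p : R) m n x y : (m <= n)%N ->
  taun p m x y <= taun p n x y.
Proof.
move=> mn; apply: le_Pr; [exact: measurable_reach..|].
by move=> w; exact: le_reach.
Qed.

Lemma taun_le_tau {R : realType} (p : R) n x y : taun p n x y <= tau p x y.
Proof.
apply: le_Pr; [exact: measurable_reach|exact: measurable_cluster|].
by move=> w h; apply/clusterP; exists n.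
Qed.

Lemma taun_approx {R : realType} (p : R) x y eps : 0 < eps ->
  exists n, tau p x y - eps <= taun p n x y.
Proof.
move=> e0; apply/not_existsP => h.
have : tau p x y <= tau p x y - eps; last by lra.
rewrite -lee_fin {1}/tau -PrE; last exact: measurable_cluster.
rewrite cluster_bigcup.
have mF n : measurable [set w : config (edge X) | reach w n x y].
  exact: measurable_reach.
have ndF : {homo (fun n => [set w : config (edge X) | reach w n x y]) :
    m n / (m <= n)%N >-> (m <= n)%O}.
  by move=> m n mn; apply/subsetPset => w; exact: le_reach.
have cv := nondecreasing_cvg_mu (mu := percolation (edge X) p) mF
  (bigcupT_measurable _ mF) ndF.
rewrite -(cvg_lim _ cv) //; apply: lime_le; first exact: (cvgP _ cv).
apply: nearW => n /=; rewrite PrE; last exact: measurable_reach.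
by rewrite lee_fin; have := h n; move/negP; rewrite -ltNge => /ltW.
Qed.

Lemma sum_taun_approx {R : realType} (p : R) x (r : seq (vertex X)) eps : 0 < eps ->
  exists n, \sum_(y <- r) tau p x y - eps <= \sum_(y <- r) taun p n x y.
Proof.
elim: r eps => [|y r IH] eps e0; first by exists 0%N; rewrite !big_nil; lra.
have e2 : 0 < eps / 2 by rewrite divr_gt0.
have [n hn] := taun_approx p x y e2; have [m hm] := IH _ e2.
exists (maxn n m); rewrite !big_cons.
have h1 : taun p n x y <= taun p (maxn n m) x y by apply: le_taun; exact: leq_maxl.
have h2 : \sum_(y <- r) taun p m x y <= \sum_(y <- r) taun p (maxn n m) x y.
  by apply: ler_sum => z _; apply: le_taun; exact: leq_maxr.
lra.
Qed.

End Reach.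

(** Open edges may be collapsed as well as mapped to open adjacencies; this covers the retractions
    of the free product onto a factor or onto a branch, besides translations and embeddings. *)
Lemma reach_map (X X' : multigraph) (w : config (edge X)) (w' : config (edge X'))
    (f : vertex X -> vertex X') n x y :
  (forall e, w e -> f (ends e).1 = f (ends e).2 \/
     open_adj w' (f (ends e).1) (f (ends e).2)) ->
  reach w n x y -> reach w' n (f x) (f y).
Proof.
move=> hf; elim: n y => [y -> //|n IH] y /= [/IH ?|[z /IH hz [e [we h]]]].
  by left.
have := hf e we; case: h => -> /= [eqf|adj].
- by left; rewrite -eqf.
- by right; exists (f z).
- by left; rewrite eqf.
- by right; exists (f z) => //; exact: open_adj_sym.
Qed.

Lemma cluster_map (X X' : multigraph) (w : config (edge X)) (w' : config (edge X'))
    (f : vertex X -> vertex X') x y :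
  (forall e, w e -> f (ends e).1 = f (ends e).2 \/
     open_adj w' (f (ends e).1) (f (ends e).2)) ->
  cluster w x y -> cluster w' (f x) (f y).
Proof.
by move=> hf /clusterP[n h]; apply/clusterP; exists n; exact: reach_map h.
Qed.

(** * Balls in locally finite graphs and the locality of bounded reachability *)

Section LocallyFinite.
Variables (X : multigraph) (inc : vertex X -> seq (edge X)).
Hypothesis incP : forall e x, (ends e).1 = x \/ (ends e).2 = x -> e \in inc x.
Variable o : vertex X.

Definition touching (V : seq (vertex X)) : seq (edge X) :=
  undup (flatten [seq inc z | z <- V]).

Fixpoint ball n : seq (vertex X) :=
  if n is m.+1 then undup (ball m ++ [seq (ends e).1 | e <- touching (ball m)]
                                  ++ [seq (ends e).2 | e <- touching (ball m)])
  else [:: o].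

Lemma ball_uniq n : uniq (ball n).
Proof. by case: n => //= n; rewrite undup_uniq. Qed.

Lemma touchingP V e x : x \in V -> (ends e).1 = x \/ (ends e).2 = x -> e \in touching V.
Proof.
move=> xV /incP ex; rewrite mem_undup; apply/flattenP; exists (inc x) => //.
exact: map_f.
Qed.

Lemma reach_ball (w : config (edge X)) n y : reach w n o y -> y \in ball n.
Proof.
elim: n y => [|n IH] y /=; first by move=> ->; rewrite inE.
rewrite mem_undup !mem_cat => -[/IH -> //|[z /IH zb [e [_ h]]]].
have te : e \in touching (ball n) by apply: touchingP zb _; case: h => ->; tauto.
apply/or3P; case: h => h; [apply: Or33|apply: Or32]; apply/mapP; exists e => //;
  by rewrite h.
Qed.

(** A path of at most n steps visits only the ball, whatever the configuration, so each of its edges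
    touches the ball. *)
Lemma depends_on_reach n y :
  depends_on [set` touching (ball n)] [set w | reach w n o y].
Proof.
move=> w w' ww'.
have sub m z : (m <= n)%N -> z \in ball m -> z \in ball n.
  move=> /subnK <-; elim: (n - m)%N => [//|k IH] /IH h.
  by rewrite addSn /= mem_undup mem_cat h.
suff h m z : (m <= n)%N -> reach w m o z -> reach w' m o z by exact: h.
elim: m z => [//|m IH] z mn /= [/IH h|[u hu [e [we h]]]].
  by left; apply: h; exact: ltnW.
right; exists u; first by apply: IH => //; exact: ltnW.
exists e; split=> //; rewrite -(ww' e) //=; apply: (@touchingP _ _ u).
  by apply: sub (reach_ball hu); exact: ltnW.
by case: h => ->; tauto.
Qed.

End LocallyFinite.

(** * Expected cluster size *)

Section ClusterSize.
Context {R : realType} (X : multigraph).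
Hypotheses (cE : countable [set: edge X]) (cV : countable [set: vertex X]).
Variables (o : vertex X) (p : R).

Section Numbering.
Variables (g : vertex X -> nat) (gI : injective g).
(** Membership of the vertex numbered [n], empty when no vertex has this number. The numbering turns
    the cluster size into a series of indicators, which can be integrated term by term. *)
Let B n : set (config (edge X)) := [set w | exists2 x, cluster w o x & g x = n].

Let B_eq n : (exists2 x, g x = n & B n = [set w | cluster w o x]) \/
  ((forall x, g x <> n) /\ B n = set0).
Proof.
have [[x gx]|h] := pselect (exists x, g x = n); [left; exists x => //|right; split].
- apply/seteqP; split => w /=; last by move=> h; exists x.
  by move=> [y hy]; rewrite -gx => /gI <-.
- by move=> x gx; apply: h; exists x.
- by apply/seteqP; split => // w [x _ gx]; apply: h; exists x.
Qed.

Let mB n : measurable (B n).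
Proof.
by case: (B_eq n) => [[x _ ->]|[_ ->]] //; exact: measurable_cluster.
Qed.

Let counting_series (w : config (edge X)) :
  counting (cluster w o) = (\sum_(0 <= n <oo) (\1_(B n) w)%:E)%E :> \bar R.
Proof.
transitivity (@counting _ R (g @` cluster w o)).
  rewrite /counting; have [fin|inf] := pselect (finite_set (cluster w o)).
    rewrite !asboolT //; last exact: finite_image.
    rewrite fset_set_image // card_imfset //.
  rewrite !asboolF // => fin; apply: inf.
  apply: sub_finite_set (finite_preimage _ fin); last by move=> x y _ _; exact: gI.
  by move=> x hx; exists x.
rewrite counting_dirac; apply: eq_eseriesr => n _.
by rewrite diracE indicE; congr (_%:R%:E); apply/idP/idP; rewrite !inE => -[x h <-]; exists x.
Qed.

Lemma expected_cluster_size_series :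
  expected_cluster_size o p = (\sum_(0 <= n <oo) (Pr p (B n))%:E)%E.
Proof.
rewrite /expected_cluster_size (eq_integral _ _ (fun w _ => counting_series w)).
rewrite integral_nneseries //.
- by apply: eq_eseriesr => n _; rewrite integral_indic // setIT; exact: PrE.
- by move=> n; apply/measurable_EFinP; exact: measurable_indic.
Qed.

Lemma measurable_counting_cluster :
  measurable_fun setT (fun w : config (edge X) => counting (cluster w o) : \bar R).
Proof.
rewrite (_ : (fun w => _) = (fun w => (\sum_(0 <= n <oo) (\1_(B n) w)%:E)%E)); last first.
  by apply/funext.
apply: ge0_emeasurable_sum => n.
  by move=> x _; rewrite lee_fin.
by move=> _; apply/measurable_EFinP; exact: measurable_indic.
Qed.

Lemma expected_cluster_size_ge_numbered r : uniq r ->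
  ((\sum_(x <- r) tau p o x)%:E <= expected_cluster_size o p)%E.
Proof.
move=> ur; rewrite expected_cluster_size_series.
pose K := (\max_(n <- map g r) n).+1.
apply: le_trans (nneseries_lim_ge K _); last by move=> n _ _; rewrite lee_fin Pr_ge0.
rewrite sumEFin lee_fin.
have -> : \sum_(x <- r) tau p o x = \sum_(n <- map g r) Pr p (B n).
  rewrite big_map; apply: eq_bigr => x _.
  case: (B_eq (g x)) => [[y /gI -> ->] //|[/(_ x)]]; by [].
rewrite (_ : \sum_(n <- map g r) Pr p (B n) =
    \sum_(0 <= n < K | n \in map g r) Pr p (B n)); last first.
  rewrite -[RHS]big_filter; apply: perm_big; apply: uniq_perm.
  - by rewrite map_inj_uniq.
  - by rewrite filter_uniq // iota_uniq.
  move=> n; rewrite mem_filter mem_index_iota /=; case: (boolP (n \in _)) => //= nr.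
  by apply/esym; rewrite ltnS; exact: (@leq_bigmax_seq _ _ predT id n nr isT).
rewrite [leRHS](bigID (fun n => n \in map g r)) /= lerDl.
by apply: sumr_ge0 => n _; exact: Pr_ge0.
Qed.

Lemma expected_cluster_size_le_numbered (M : R) :
  (forall r, uniq r -> \sum_(x <- r) tau p o x <= M) ->
  (expected_cluster_size o p <= M%:E)%E.
Proof.
move=> hM; rewrite expected_cluster_size_series.
(* Partial inverse of [g]: it turns an initial segment of the series into a sum over a
   duplicate-free list of vertices. *)
pose h n : option (vertex X) :=
  if pselect (exists x, g x = n) is left P then Some (projT1 (cid P)) else None.
have hK : ocancel h g.
  by move=> n; rewrite /h; case: pselect => //= P; case: cid.
apply: lime_le.
  by apply: is_cvg_nneseries => n _ _; rewrite lee_fin Pr_ge0.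
apply: nearW => K; rewrite sumEFin lee_fin.
apply: le_trans (hM (pmap h (index_iota 0 K)) _); last first.
  by apply: (pmap_uniq hK); exact: iota_uniq.
rewrite big_pmap; apply: ler_sum => n _.
case: (B_eq n) => [[x gx ->]|[hn ->]]; last first.
  by rewrite {1}/Pr measure0; case: (h n) => [x|] /=; rewrite ?tau_ge0.
have := hK n; rewrite /h; case: pselect => [P|[]]; last by exists x.
by move=> /=; case: cid => y /= _ gy; rewrite (gI (etrans gx (esym gy))).
Qed.

End Numbering.

Lemma expected_cluster_size_ge r : uniq r ->
  ((\sum_(x <- r) tau p o x)%:E <= expected_cluster_size o p)%E.
Proof.
have /countable_injP[g gI] := cV.
by apply: (@expected_cluster_size_ge_numbered g) => x y; apply: gI; rewrite inE.
Qed.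

Lemma expected_cluster_size_le (M : R) : (forall r, uniq r -> \sum_(x <- r) tau p o x <= M) ->
  (expected_cluster_size o p <= M%:E)%E.
Proof.
have /countable_injP[g gI] := cV.
by apply: (@expected_cluster_size_le_numbered g) => x y; apply: gI; rewrite inE.
Qed.

Lemma measurable_infinite_cluster :
  measurable [set w : config (edge X) | infinite_set (cluster w o)].
Proof.
have /countable_injP[g gI] := cV.
have mc : measurable_fun setT (fun w : config (edge X) => counting (cluster w o) : \bar R).
  by apply: (@measurable_counting_cluster g) => x y; apply: gI; rewrite inE.
rewrite (_ : [set w | _] = [set w | counting (cluster w o) = +oo%E :> \bar R]).
  by have := mc measurableT [set +oo%E] (emeasurable_set1 _); rewrite setTI.
apply/seteqP; split => w /=; rewrite /counting; first by move=> inf; rewrite asboolF.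
by case: asboolP.
Qed.

(** The cluster size is then integrable, hence almost everywhere finite. *)
Lemma theta_eq0 (M : R) : (forall r, uniq r -> \sum_(x <- r) tau p o x <= M) ->
  theta o p = 0%E.
Proof.
move=> /expected_cluster_size_le hM; have /countable_injP[g gI'] := cV.
have gI : injective g by move=> x y; apply: gI'; rewrite inE.
have mc := measurable_counting_cluster gI.
have ic : (percolation (edge X) p).-integrable setT
    (fun w => counting (cluster w o) : \bar R).
  apply/integrableP; split => //; apply: le_lt_trans (ltry M); apply: le_trans hM.
  rewrite le_eqVlt; apply/orP; left; apply/eqP; apply: eq_integral => w _.
  by rewrite gee0_abs // /counting; case: ifP.
have := integrable_ae measurableT ic.
move=> [N [mN N0 hN]]; apply/eqP; rewrite eq_le measure_ge0 andbT -N0.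
apply: le_measure; rewrite ?inE //; first exact: measurable_infinite_cluster.
move=> w inf; apply: hN => /= /(_ I); rewrite /counting asboolF //.
Qed.
End ClusterSize.

(** * Exploration of a ball *)

Lemma ler_sum_support (R : realDomainType) (I : eqType) (r s : seq I) (F : I -> R) :
  uniq r -> uniq s -> (forall x, 0 <= F x) ->
  (forall x, x \in r -> x \notin s -> F x = 0) ->
  \sum_(x <- r) F x <= \sum_(x <- s) F x.
Proof.
move=> ur us F0 Frs; rewrite (bigID (mem s)) /= [X in _ + X]big1_seq ?addr0; last first.
  by move=> x /andP[? ?]; exact: Frs.
rewrite -big_filter [leRHS](bigID (mem r)) /= -[X in _ <= X + _]big_filter.
rewrite (perm_big [seq x <- s | x \in r]); first by rewrite lerDl sumr_ge0.
by apply: uniq_perm; rewrite ?filter_uniq // => x; rewrite !mem_filter andbC.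
Qed.

Section Exploration.
Variables (X : multigraph) (inc : vertex X -> seq (edge X)).
Hypothesis incP : forall e x, (ends e).1 = x \/ (ends e).2 = x -> e \in inc x.
Hypotheses (cE : countable [set: edge X]) (cV : countable [set: vertex X]).
Variable o : vertex X.
Implicit Types (w : config (edge X)) (K : {fset vertex X}).

Let B n := ball inc o n.

Definition meets K (e : edge X) : bool := ((ends e).1 \in K) || ((ends e).2 \in K).

Definition off K w : config (edge X) := fun e => w e && ~~ meets K e.

Definition explored n K : set (config (edge X)) :=
  [set w | forall z, reach w n o z <-> z \in K].

Lemma measurable_explored n K : measurable (explored n K).
Proof.
pose D z : set (config (edge X)) :=
  if z \in K then ~` [set w | reach w n o z] else [set w | reach w n o z].
rewrite (_ : explored n K = ~` \bigcup_z D z).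
  apply: measurableC; apply: countable_bigcupT_measurable => // z; rewrite /D.
  by case: ifP => _; [apply: measurableC|]; exact: measurable_reach.
apply/seteqP; split => w.
  by move=> h [z _]; rewrite /D; case: ifP => zK; rewrite /= h zK.
move=> h z; split => hz.
  by apply/negPn/negP => zK; apply: h; exists z => //; rewrite /D (negPf zK).
by apply: contrapT => nz; apply: h; exists z => //; rewrite /D hz.
Qed.

Lemma measurable_off K : measurable_fun setT (off K).
Proof.
apply: measurable_config => e; rewrite /off; case: (meets K e).
  by rewrite (_ : [set _ | _] = set0) //; apply/seteqP; split => // w /andP[].
rewrite (_ : [set _ | _] = open_event e); first exact: measurable_open.
by apply/seteqP; split => w /=; rewrite andbT.
Qed.

(** Each of the first n + 1 steps starts at a vertex reached in at most n steps, that is, in [K];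
    hence it uses an edge meeting [K]. This is why one step beyond the explored radius is still
    determined. *)
Lemma explored_local n K w w' m z : explored n K w ->
  (forall e, meets K e -> w e = w' e) -> (m <= n.+1)%N ->
  reach w m o z <-> reach w' m o z.
Proof.
move=> hK ww'; elim: m z => [//|m IH] z mn.
have {}IH u : reach w m o u <-> reach w' m o u by apply: IH; exact: ltnW.
have sub u : reach w m o u -> u \in K by move=> h; apply/hK; exact: le_reach h.
split=> /= -[/IH h|[u hu [e [we h]]]]; [by left| |by left|].
- right; exists u; [exact/IH|exists e; split=> //].
  by rewrite -ww' // /meets; case: h => -> /=; rewrite (sub u) ?orbT.
- move/IH: hu => hu; right; exists u => //; exists e; split=> //.
  by rewrite ww' // /meets; case: h => -> /=; rewrite (sub u) ?orbT.
Qed.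

Definition frontier n K y : set (config (edge X)) :=
  explored n K `&` [set w | reach w n.+1 o y] `&` ~` [set w | reach w n o y].

Lemma measurable_frontier n K y : measurable (frontier n K y).
Proof.
apply: measurableI; last by apply: measurableC; exact: measurable_reach.
by apply: measurableI; [exact: measurable_explored|exact: measurable_reach].
Qed.

Lemma frontier_depends n K y : depends_on (fun e => meets K e) (frontier n K y).
Proof.
move=> w w' ww' [[hK h1] h2].
have loc z : reach w n o z <-> reach w' n o z.
  by apply: (explored_local _ hK ww'); exact: leqnSn.
split; first split; last by move=> /= /loc.
  by move=> z; rewrite -loc.
by apply/(explored_local _ hK ww').
Qed.

(** Induction on [N]. If the end point lies within n + 1 steps, the decomposition is restarted
    there. Otherwise the last edge avoids [K], since an end in [K] would bring the end point within
    n + 1 steps. *)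
Lemma reach_frontier w n N x : reach w (n.+1 + N) o x ->
  reach w n o x \/ exists2 y, reach w n.+1 o y /\ ~ reach w n o y &
    forall K, explored n K w -> reach (off K w) N y x.
Proof.
have first z : reach w n.+1 o z -> reach w n o z \/ exists2 y,
    reach w n.+1 o y /\ ~ reach w n o y &
    forall N K, explored n K w -> reach (off K w) N y z.
  move=> hz; have [h|h] := pselect (reach w n o z); [by left|right].
  by exists z => // *; exact: reach_refl.
elim: N x => [|N IH] x; first rewrite addn0.
  by move/first => [|[y hy h]]; [left|right; exists y => // K; exact: h].
rewrite addnS => -[/IH[h|[y hy h]]|[z /IH[hz|[y hy h]] [e [we he]]]].
- by left.
- by right; exists y => // K /h; left.
- have /first : reach w n.+1 o x by right; exists z => //; exists e.
  by move=> [|[y hy h]]; [left|right; exists y => // K; exact: h].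
- have [/first|hx] := pselect (reach w n.+1 o x).
    by move=> [|[y' hy' h']]; [left|right; exists y' => // K; exact: h'].
  right; exists y => // K hK; right; exists z; first exact: h.
  exists e; split=> //; rewrite /off we /= /meets negb_or.
  have nz : z \notin K.
    apply/negP => /hK hz; apply: hx; right; exists z => //; by exists e.
  have nx : x \notin K by apply/negP => /hK hx'; apply: hx; left.
  by case: he => -> /=; rewrite nz nx.
Qed.

Context {R : realType}.

(* Given the ball K of radius n, a path to x leaves K for the last time at a vertex y at
   distance n + 1, and the rest of it avoids the edges meeting K, whose state
   determines K and its frontier. *)
Lemma taun_frontier (p : R) n N x : 0 <= p <= 1 ->
  taun p (n.+1 + N) o x <= taun p n o x +
    \sum_(y <- B n.+1) (taun p n.+1 o y - taun p n o y) * taun p N y x.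
Proof.
move=> p01.
pose H y K := frontier n K y.
pose J y K := [set w | reach (off K w) N y x].
have mH y K : measurable (H y K) by exact: measurable_frontier.
have mJ y K : measurable (J y K).
  exact: (measurable_preim (measurable_off K) (measurable_reach cE N y x)).
have mHJ y K : measurable (H y K `&` J y K) by exact: measurableI.
(* All candidates for the set reached in n steps, namely the subsets of the deterministic ball. *)
pose r := enum_fset (fpowerset [fset z in B n]%fset).
pose U y := some_of r (fun K => H y K `&` J y K).
have mU y : measurable (U y) by exact: measurable_some_of.
have mUU := measurable_some_of (B n.+1) mU.
have mn := measurable_reach cE n o x.
apply: (@le_trans _ _ (Pr p ([set w | reach w n o x] `|` some_of (B n.+1) U))).
  apply: le_Pr => //; [exact: measurable_reach|exact: measurableU|].
  move=> w /reach_frontier[|[y [h1 h2] hy]]; [by left|right].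
  exists y; first exact: (reach_ball incP h1).
  pose K := [fset z in B n | `[< reach w n o z >]]%fset.
  have hK : explored n K w.
    move=> z; rewrite !inE; split=> [hz|/andP[_ /asboolP//]].
    by rewrite (reach_ball incP hz); apply/asboolP.
  exists K; last by split; [split; [split|]|exact: hy].
  by rewrite fpowersetE; apply/fsubsetP => z; rewrite !inE => /andP[].
apply: (le_trans (PrU_le _ mn mUU)); rewrite lerD2l.
apply: (le_trans (Pr_some_of_le _ _ mU)); apply: ler_sum => y _.
apply: (le_trans (Pr_some_of_le _ _ (mHJ y))).
apply: (@le_trans _ _ (\sum_(K <- r) Pr p (H y K) * taun p N y x)).
  apply: ler_sum => K _.
  rewrite (Pr_indep cE p01 (mH y K) (mJ y K) (D := fun e => meets K e)
    (D' := fun e => ~~ meets K e)).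
  - apply: ler_wpM2l; first exact: Pr_ge0.
    apply: le_Pr => //; first exact: measurable_reach.
    by move=> w; apply: increasing_reach => e /andP[].
  - exact: frontier_depends.
  - move=> w w' ww'; rewrite /J /= (_ : off K w = off K w') //.
    apply/funext => e; rewrite /off; case: (boolP (meets K e)) => h.
      by rewrite !andbF.
    by rewrite ww'.
  - by move=> e ->.
(* Different values of [K] exclude each other, so the frontier probabilities add up to at most the
   probability that [y] is at open distance exactly n + 1. *)
rewrite -mulr_suml; apply: ler_wpM2r; first exact: taun_ge0.
rewrite (_ : _ - _ = Pr p ([set w | reach w n.+1 o y] `&` ~` [set w | reach w n o y])).
  apply: Pr_disjoint_le => //.
  - apply: measurableI; [exact: measurable_reach|].
    by apply: measurableC; exact: measurable_reach.
  - exact: fset_uniq.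
  - move=> K K' KK'; apply/seteqP; split => // w [[[h _] _] [[h' _] _]].
    by move/eqP: KK'; apply; apply/fsetP => z; apply/idP/idP => [/h/h'|/h'/h].
  - by move=> K w [[_ ? ?]].
have mA := measurable_reach cE n.+1 o y; have mB := measurable_reach cE n o y.
apply/eqP; rewrite subr_eq /taun -PrU_disjoint //.
- apply/eqP; congr Pr; apply/seteqP; split => w.
    by move=> h; have [?|?] := pselect (reach w n o y); [right|left].
  by case=> [[]//|h]; left.
- by apply: measurableI => //; exact: measurableC.
- by apply/seteqP; split => // w [[_ h] /h].
Qed.

End Exploration.

(** * Percolation on Cayley graphs *)

Section CayleyPercolation.
Context {R : realType} (G : groupType) (S : {fset G}).
Hypothesis genS : generates S.
Let X := cayley S.
Implicit Types (p q : R) (x y z h : G) (w : config (edge X)) (r : seq G).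

Lemma countable_vertex : countable [set: vertex X].
Proof. exact: generates_countable genS. Qed.

Lemma countable_edge : countable [set: edge X].
Proof.
rewrite -setXTT; apply: countableX; first exact: generates_countable genS.
exact: countableP.
Qed.

Let cE := countable_edge.
Let cV := countable_vertex.

Definition incident (x : vertex X) : seq (edge X) :=
  [seq (x, s) | s <- enum {: S}] ++ [seq ((x * (val s)^-1)%g, s) | s <- enum {: S}].

Lemma incidentP (e : edge X) (x : vertex X) :
  (ends e).1 = x \/ (ends e).2 = x -> e \in incident x.
Proof.
case: e => g s [] /= <-; rewrite mem_cat; apply/orP; [left|right]; apply/mapP.
  by exists s => //; rewrite mem_enum.
by exists s; rewrite ?mem_enum // mulgK.
Qed.

Definition shift h (e : edge X) : edge X := ((h * e.1)%g, e.2).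

Lemma shift_inj h : injective (shift h).
Proof. by move=> [x s] [y t] [/mulgI -> ->]. Qed.

Lemma shift_reach h n w x y :
  reach (w \o shift h : config (edge X)) n x y <-> reach w n (h * x)%g (h * y)%g.
Proof.
split.
  apply: (@reach_map X X _ w (fun z => (h * z)%g)) => -[g s] /= we; right.
  by exists (shift h (g, s)); split=> //; left; rewrite /= mulgA.
move=> hr; rewrite -(mulKg h x) -(mulKg h y).
apply: (@reach_map X X w _ (fun z => (h^-1 * z)%g)) hr => -[g s] /= we; right.
exists ((h^-1 * g)%g, s); split; last by left; rewrite /= mulgA.
by rewrite /= /shift /= mulVKg.
Qed.

Lemma taun_shift p n h x y : 0 <= p <= 1 ->
  taun (X := X) p n (h * x)%g (h * y)%g = taun (X := X) p n x y.
Proof.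
move=> p01; rewrite /taun.
rewrite -(Pr_embed cE cE p01 (shift_inj (h := h)) (measurable_reach cE n x y)).
by congr Pr; apply/seteqP; split => w /= hr; apply/shift_reach.
Qed.

Lemma cluster_shift h w x y :
  cluster (w \o shift h : config (edge X)) x y <-> cluster w (h * x)%g (h * y)%g.
Proof.
by split=> /clusterP[n hr]; apply/clusterP; exists n; apply/shift_reach.
Qed.

Definition tau1 p x : R := tau (X := X) p 1%g x.

Lemma tau1_ge0 p x : 0 <= tau1 p x. Proof. exact: tau_ge0. Qed.

Lemma tau11 p : tau1 p 1%g = 1. Proof. exact: tau_refl. Qed.

(** The 1 is the contribution of the origin. Together with [chi_le] this presents chi - 1 as the
    supremum of the sums of [tau1] over duplicate-free lists avoiding the identity. *)
Lemma chi_ge p r : uniq r -> 1%g \notin r ->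
  ((1 + \sum_(x <- r) tau1 p x)%:E <= chi S p)%E.
Proof.
move=> ur r1; rewrite -(tau11 p) -(big_cons _ _ _ _ xpredT).
by apply: (expected_cluster_size_ge cE cV); rewrite /= r1.
Qed.

Lemma chi_le p (M : R) :
  (forall r, uniq r -> 1%g \notin r -> \sum_(x <- r) tau1 p x <= M) ->
  (chi S p <= (1 + M)%:E)%E.
Proof.
move=> hM; apply: (expected_cluster_size_le cE cV) => r ur.
have /= := hM (rem 1%g r) (rem_uniq _ ur); rewrite (mem_rem_uniq _ ur) !inE eqxx.
move=> /(_ isT) h; case: (boolP (1%g \in r)) => r1.
  by rewrite (perm_big _ (perm_to_rem r1)) big_cons tau_refl lerD2l.
by rewrite rem_id // in h; apply: (le_trans h); rewrite lerDr.
Qed.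

Lemma le_tau1 p p' x : 0 <= p -> p <= p' -> p' <= 1 -> tau1 p x <= tau1 p' x.
Proof.
move=> p0 pp' p'1; apply: (Pr_increasing cE) => //; first exact: measurable_cluster.
exact: increasing_cluster.
Qed.

(* Thinning by q keeps all the k edges within distance n of the origin with
   probability q^k, hence the event of being reached in n steps. *)
Lemma tau1_left p x (eps : R) : 0 <= p <= 1 -> 0 < eps -> exists2 q0 : R, 0 <= q0 < 1 &
  forall q, q0 <= q <= 1 -> tau1 p x - eps <= tau1 (p * q) x.
Proof.
move=> p01 e0.
have [n hn] : exists n, tau1 p x - eps / 2 <= taun (X := X) p n 1%g x.
  by apply: taun_approx; rewrite ?divr_gt0.
pose F := touching incident (ball incident (1%g : vertex X) n).
have uF : uniq F by exact: undup_uniq.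
have dF := @depends_on_reach X incident incidentP 1%g n x.
have mx := measurable_reach cE n (1%g : vertex X) x.
pose k := (size F)%:R : R; have k0 : 0 <= k by [].
(* Chosen so that [k * d <= eps / 2] and [d <= 1] at once; the summand [eps] of the denominator
   serves the latter. *)
pose d := eps / 2 / (k + 1 + eps).
have D0 : 0 < k + 1 + eps by lra.
have d0 : 0 < d by apply: divr_gt0; lra.
have dD : d * (k + 1 + eps) = eps / 2 by rewrite /d divfK // gt_eqF.
have kd : k * d <= eps / 2 by nra.
have d1 : d <= 1 by rewrite /d ler_pdivrMr; lra.
exists (1 - d) => [|q /andP[q0 q1]]; first lra.
have q01 : 0 <= q <= 1 by lra.
have h1 : taun (X := X) p n 1%g x * q ^+ size F <= taun (X := X) (p * q) n 1%g x.
  exact: Pr_thin_local.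
have h2 : taun (X := X) (p * q) n 1%g x <= tau1 (p * q) x by exact: taun_le_tau.
have bern : 1 - k * (1 - q) <= q ^+ size F.
  by rewrite -{2}(subKr 1 q); apply: exprn_onem_ge; lra.
have h3 : 0 <= taun (X := X) p n 1%g x <= 1.
  by rewrite taun_ge0 /taun Pr_le1.
have h4 : k * (1 - q) <= eps / 2 by apply: le_trans kd; rewrite ler_wpM2l //; lra.
have kq : 0 <= k * (1 - q) by apply: mulr_ge0; lra.
by case/andP: h3 => h5 h6; nra.
Qed.

Lemma sum_tau1_left p r (eps : R) : 0 <= p <= 1 -> 0 < eps -> exists2 q0 : R, 0 <= q0 < 1 &
  forall q, q0 <= q <= 1 ->
    \sum_(x <- r) tau1 p x - eps <= \sum_(x <- r) tau1 (p * q) x.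
Proof.
move=> p01; elim: r eps => [|x r IH] eps e0.
  by exists 0 => [|q _]; rewrite ?lexx ?ltr01 // !big_nil; lra.
have e2 : 0 < eps / 2 by rewrite divr_gt0.
have [q1 hq1 h1] := tau1_left x p01 e2; have [q2 hq2 h2] := IH _ e2.
exists (Num.max q1 q2).
  by case/andP: hq1 hq2 => ? ? /andP[? ?]; rewrite le_max gt_max; apply/andP; split;
    [apply/orP; left|apply/andP].
move=> q /andP[]; rewrite ge_max => /andP[a b] c.
have := h1 q; have := h2 q; rewrite a b c !big_cons => /(_ isT) + /(_ isT).
lra.
Qed.

(* Thinning closes all the edges at the origin with positive probability. *)
Lemma tau1_thin_strict q : 0 <= q < 1 -> exists2 c : R, 0 <= c < 1 &
  forall p x, 0 <= p <= 1 -> x != 1%g -> tau1 (p * q) x <= c * tau1 p x.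
Proof.
move=> q01; pose F := undup (incident 1%g).
have uF : uniq F by exact: undup_uniq.
have h0 : 0 < (1 - q) ^+ size F by apply: exprn_gt0; lra.
have h1 : (1 - q) ^+ size F <= 1 by apply: exprn_ile1; lra.
exists (1 - (1 - q) ^+ size F) => [|p x p01 x1]; first lra.
rewrite [leRHS]mulrC; apply: (Pr_thin_hit cE) => //.
- lra.
- exact: measurable_cluster.
- exact: increasing_cluster.
move=> w /clusterP[n]; elim: n (x) x1 => [|n IH] y y1 /=.
  by move=> e; rewrite e eqxx in y1.
case=> [/IH|[z hz [e [we he]]]]; first exact.
have [z1|/IH] := eqVneq z 1%g; last exact.
exists e => //; rewrite mem_undup; apply: incidentP; rewrite -z1.
by case: he => ->; [left|right].
Qed.

(* The expected size A n of the open ball of radius n satisfies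
   A (n + 1 + N) <= A n + (A (n + 1) - A n) * A N. If A is bounded, then some increment
   is less than 1; it is still so at a slightly larger p', where A is then bounded. *)
Lemma summable_tau1_open p (M : R) : 0 <= p < 1 ->
  (forall r, uniq r -> \sum_(x <- r) tau1 p x <= M) ->
  exists p' M' : R, [/\ p < p', p' <= 1 &
    forall r, uniq r -> \sum_(x <- r) tau1 p' x <= M'].
Proof.
move=> p01 hM.
pose B n := ball incident (1%g : vertex X) n.
have uB n : uniq (B n) by exact: ball_uniq.
pose A t n : R := \sum_(x <- B n) taun (X := X) t n 1%g x.
have zB t n x : x \notin B n -> taun (X := X) t n 1%g x = 0.
  move=> xB; rewrite /taun (_ : [set w | _] = set0); first by rewrite /Pr measure0.
  apply/seteqP; split => // w /(reach_ball incidentP) h.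
  by move/negP: xB; apply.
have AE t n r : uniq r -> \sum_(x <- r) taun (X := X) t n 1%g x <= A t n.
  move=> ur; apply: ler_sum_support => //; first by move=> x; exact: taun_ge0.
  by move=> x _; exact: zB.
have AS t n : A t n <= \sum_(x <- B n.+1) taun (X := X) t n 1%g x.
  apply: ler_sum_support => // x; first exact: taun_ge0.
  by move=> xB; rewrite /B /= mem_undup mem_cat xB.
have ASS t n : A t n <= A t n.+1.
  by apply: (le_trans (AS t n)); apply: ler_sum => x _; exact: le_taun.
have A0 t n : 0 <= A t n by apply: sumr_ge0 => x _; exact: taun_ge0.
have rec t n N : 0 <= t <= 1 -> A t (n.+1 + N)%N <= A t n + (A t n.+1 - A t n) * A t N.
  move=> t01.
  apply: (@le_trans _ _ (\sum_(x <- B (n.+1 + N)%N) (taun (X := X) t n 1%g x +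
    \sum_(y <- B n.+1) (taun (X := X) t n.+1 1%g y - taun (X := X) t n 1%g y) *
       taun (X := X) t N y x))).
    by apply: ler_sum => x _; exact: (taun_frontier incidentP cE cV).
  rewrite big_split; apply: lerD; first exact: AE.
  rewrite exchange_big.
  apply: (@le_trans _ _ (\sum_(y <- B n.+1)
    (taun (X := X) t n.+1 1%g y - taun (X := X) t n 1%g y) * A t N)).
    apply: ler_sum => y _; rewrite -mulr_sumr; apply: ler_wpM2l.
      by rewrite subr_ge0 le_taun.
    (* By translation invariance a sum of two-point functions from [y] is a sum from the identity
       over the translated list. *)
    apply: le_trans (AE t N [seq (y^-1 * x)%g | x <- B (n.+1 + N)%N] _); last first.
      by rewrite map_inj_uniq //; exact: mulgI.
    rewrite big_map; apply: ler_sum => x _.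
    by rewrite -[leRHS](taun_shift N y) // mulg1 mulVKg.
  rewrite -mulr_suml; apply: ler_wpM2r => //.
  by rewrite sumrB lerB.
have AM n : A p n <= M.
  by apply: le_trans (hM (B n) (uB n)); apply: ler_sum => x _; exact: taun_le_tau.
(* Otherwise [A p] would grow linearly. The bound 1/2 leaves a margin: the change of parameter costs
   another 1/4. *)
have [n hn] : exists n, A p n.+1 - A p n < 1 / 2.
  apply/not_existsP => h.
  have lin n : n%:R / 2 <= A p n.
    elim: n => [|n IH]; first by rewrite mul0r.
    by rewrite -natr1; have /negP := h n; rewrite -leNgt => hh; lra.
  have [k hk] : exists k : nat, 2 * M < k%:R.
    by exists (Num.truncn (2 * M)).+1; exact: truncnS_gt.
  by have := lin k; have := AM k; lra.
pose F := touching incident (B n.+1).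
have uF : uniq F by exact: undup_uniq.
(* By [Pr_local_right] each vertex of the ball contributes at most [(size F)%:R * eps] to the growth
   of [A _ n.+1], in total [k * eps]. *)
pose k := (size (B n.+1))%:R * (size F)%:R : R.
have k0 : 0 <= k by rewrite mulr_ge0.
pose eps := 1 / 4 / (k + 1) : R.
have k1 : 0 < k + 1 by lra.
have e0 : 0 < eps by apply: divr_gt0; lra.
have eK : eps * (k + 1) = 1 / 4 by rewrite /eps divfK // gt_eqF.
have ke : k * eps <= 1 / 4 by nra.
have e1 : eps <= 1 by rewrite /eps ler_pdivrMr; lra.
(* Equivalently [1 - p' = (1 - p) * (1 - eps)]: the closed edges are thinned by [1 - eps]. Here
   [p < 1] makes [p'] larger than [p]. *)
pose p' := p + (1 - p) * eps.
have pp' : p < p' by rewrite /p' ltrDl mulr_gt0 //; lra.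
have p'1 : p' <= 1 by rewrite /p'; nra.
have p'01 : 0 <= p' <= 1 by lra.
have Ap' : A p' n.+1 <= A p n.+1 + 1 / 4.
  apply: (@le_trans _ _ (\sum_(x <- B n.+1) (taun (X := X) p n.+1 1%g x + (size F)%:R * eps))).
    apply: ler_sum => x _; apply: (Pr_local_right cE) => //; [lra|lra|..].
      exact: measurable_reach.
    exact: (@depends_on_reach X incident incidentP 1%g n.+1 x).
  rewrite big_split lerD2l big_const_seq count_predT iter_addr_0 -[leLHS]mulr_natl mulrA.
  exact: ke.
have App' : A p n <= A p' n.
  apply: ler_sum => x _; apply: (Pr_increasing cE); [lra|lra|lra|..].
    exact: measurable_reach.
  exact: increasing_reach.
have d34 : A p' n.+1 - A p' n <= 3 / 4 by lra.
(* The recursion and monotonicity give [A p' N <= A p' n + 3 / 4 * A p' N]. *)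
have bound N : A p' N <= 4 * A p' n.
  have h1 := rec p' n N p'01.
  have h2 : A p' N <= A p' (n.+1 + N)%N.
    elim: (n.+1) => [//|m IH]; apply: (le_trans IH); exact: ASS.
  have := A0 p' N; have := ASS p' n; nra.
exists p', (4 * A p' n); split => // r ur.
apply/ler_addgt0Pr => e he; have [m hm] := sum_taun_approx cE p' 1%g r he.
have := AE p' m r ur; have := bound m.
move: hm; rewrite /tau1; lra.
Qed.

End CayleyPercolation.

(** * Words of the free product *)

Section Words.
Local Open Scope group_scope.
Variables G1 G2 : groupType.
Notation letter := (G1 + G2)%type.
Notation G := (freeProd G1 G2).
Implicit Types (x y z : letter) (w : seq letter) (v g : G) (b c : bool).

(** The factors are indexed by the values of [side], so that each statement is made once for both
    and the alternation of letters becomes negation. *)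
Definition grp b : groupType := if b then G1 else G2.
Definition inj_letter b : grp b -> letter := if b return grp b -> letter then inl else inr.
Definition letter_coord b : letter -> grp b :=
  if b return letter -> grp b then fun x => if x is inl a then a else 1
  else fun x => if x is inr a then a else 1.

Lemma letter_coordK b : cancel (@inj_letter b) (letter_coord b). Proof. by case: b. Qed.

Lemma inj_letterK b x : side x = b -> inj_letter (letter_coord b x) = x.
Proof. by case: x b => a []. Qed.

Lemma side_inj_letter b (a : grp b) : side (inj_letter a) = b. Proof. by case: b a. Qed.

Lemma letter_coord_off b x : side x != b -> letter_coord b x = 1. Proof. by case: x b => a []. Qed.

Lemma trivial_inj_letter b (a : grp b) : trivial_letter (inj_letter a) = (a == 1).
Proof. by case: b a. Qed.

Lemma lcons_inj_letter b (a a' : grp b) w :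
  lcons (inj_letter a) (inj_letter a' :: w) = if a * a' == 1 then w else inj_letter (a * a') :: w.
Proof. by case: b a a'. Qed.

Definition emb b (a : grp b) : G := fpletter (inj_letter a).

Lemma embM b : {morph @emb b : a a' / a * a'}.
Proof. by case: b => a a'; [exact: fpinlM|exact: fpinrM]. Qed.

Lemma emb_word b (a : grp b) : fpword (emb a) = if a == 1 then [::] else [:: inj_letter a].
Proof. by case: b a. Qed.

Lemma emb1 b : emb (1 : grp b) = 1.
Proof. by apply: val_inj; rewrite /= emb_word eqxx. Qed.

Definition head_coord b w : grp b := if w is x :: _ then letter_coord b x else 1.
(** Retraction of the vertex set onto the copy of a factor through the origin: every vertex goes to
    the point of this copy at which its branch is attached. It is a map of graphs with collapsed
    edges, not of groups. *)
Definition proj b v : grp b := head_coord b (fpword v).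

Lemma projK b : cancel (@emb b) (proj b).
Proof.
move=> a; rewrite /proj emb_word; case: eqP => [-> //|_] /=; exact: letter_coordK.
Qed.

Lemma emb_inj b : injective (@emb b). Proof. exact: can_inj (projK (b := b)). Qed.

Lemma proj_off b c (a : grp c) : c != b -> proj b (emb a) = 1.
Proof.
move=> cb; rewrite /proj emb_word; case: eqP => //= _.
by apply: letter_coord_off; rewrite side_inj_letter.
Qed.

Lemma reduced_cons x w : reduced (x :: w) =
  [&& ~~ trivial_letter x, reduced w & if w is y :: _ then side x != side y else true].
Proof. by case: w => [|y w]; rewrite /reduced /= ?andbT // -!andbA; do !bool_congr. Qed.

(** Right multiplication by a letter only alters the end of a reduced word. The side of the head is
    the part of this fact that propagates by induction, as it is what decides whether [lcons] merges
    letters. *)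
Lemma word_mul_head w c (a : grp c) : reduced w ->
  if word_mul w (fpword (emb a)) is y :: _ then
    if w is x :: _ then side y = side x else side y = c else True.
Proof.
elim: w => [|x w IH] /=.
  by rewrite emb_word; case: eqP => //= _ _; rewrite side_inj_letter.
rewrite reduced_cons => /and3P[tx rw hw].
have {IH} := IH rw; rewrite -/(word_mul w (fpword (emb a))).
have rm := reduced_word_mul w (fpwordP (emb a)).
case: w rw hw rm => [_ _ _ _|z w rw xz rm hz].
  rewrite /= emb_word; have [_|a1] := eqVneq a 1.
    by case: (x) => d /=; case: ifP.
  have [xc|xc] := eqVneq (side x) c; last first.
    by rewrite lcons_id // /reduced /= tx trivial_inj_letter a1 /= side_inj_letter xc.
  move: a a1 tx; rewrite -xc => a a1 tx.
  by rewrite -[x in lcons x](inj_letterK (erefl (side x))) lcons_inj_letter;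
    case: ifP; rewrite ?side_inj_letter.
suff -> : lcons x (word_mul (z :: w) (fpword (emb a))) =
    x :: word_mul (z :: w) (fpword (emb a)) by [].
case: (word_mul (z :: w) _) rm hz => [|y m] rm yz; apply: lcons_id;
  by rewrite reduced_cons tx rm // yz.
Qed.

(** The first letter can change only when the word is a single letter of the factor that
    multiplies. *)
Lemma head_stable v c (a : grp c) y w : fpword v = y :: w -> (w != [::]) || (side y != c) ->
  exists w', fpword (v * emb a) = y :: w'.
Proof.
move=> vE hw; exists (word_mul w (fpword (emb a))).
have := fpwordP v; rewrite -[fpword (v * _)]/(word_mul (fpword v) _) vE.
rewrite reduced_cons => /and3P[ty rw yw].
rewrite -[LHS]/(lcons y (word_mul w (fpword (emb a)))).
have rm := reduced_word_mul w (fpwordP (emb a)).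
have := word_mul_head a rw; case: (word_mul w _) rm => [|z m] rm zw; apply: lcons_id;
  rewrite reduced_cons ty rm //=.
by case: (w) hw yw zw => [|x w'] /= hw yw ->.
Qed.

Lemma vertex_cases v c : (exists a : grp c, v = emb a) \/
  (exists y w, fpword v = y :: w /\ (w != [::]) || (side y != c)).
Proof.
case E: (fpword v) => [|y w].
  by left; exists 1; apply: val_inj; rewrite /= emb_word eqxx.
have [wy|] := boolP ((w != [::]) || (side y != c)); first by right; exists y, w.
rewrite negb_or !negbK => /andP[/eqP w0 /eqP yc]; left; exists (letter_coord c y).
apply: val_inj; rewrite /= emb_word E w0 inj_letterK // ifF //.
have := fpwordP v; rewrite E reduced_cons => /and3P[+ _ _].
by rewrite -[y in trivial_letter y](inj_letterK yc) trivial_inj_letter => /negPf.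
Qed.

Lemma fpletterE x : fpletter x = emb (letter_coord (side x) x).
Proof. by rewrite /emb inj_letterK. Qed.

Definition branch x v : bool := if fpword v is y :: _ then y == x else false.

Lemma branchP x v : branch x v -> exists w, fpword v = x :: w.
Proof. by rewrite /branch; case: fpword => // y w /eqP ->; exists w. Qed.

Lemma branch_letter x : ~~ trivial_letter x -> branch x (fpletter x).
Proof. by move=> tx; rewrite /branch; case: x tx => a /= /negPf ->; rewrite eqxx. Qed.

Lemma branch_emb x c (a : grp c) : branch x (emb a) -> c = side x /\ emb a = fpletter x.
Proof.
rewrite /branch emb_word; case: eqP => //= _ /eqP <-; by rewrite side_inj_letter.
Qed.

Definition word_val w : G := \prod_(x <- w) fpletter x.

Lemma word_val_cons x w : word_val (x :: w) = fpletter x * word_val w.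
Proof. exact: big_cons. Qed.

Lemma word_valK w : reduced w -> fpword (word_val w) = w.
Proof. by move=> rw; rewrite /word_val -[w in LHS]/(fpword (FreeProd rw)) -fp_prod. Qed.

Lemma fpwordK v : word_val (fpword v) = v.
Proof. by rewrite /word_val -fp_prod. Qed.

End Words.

(** * Percolation on the free product *)

Lemma ler_sum_subset (R : realDomainType) (I : eqType) (r s : seq I) (F : I -> R) :
  uniq r -> (forall x, 0 <= F x) -> {subset r <= s} ->
  \sum_(x <- r) F x <= \sum_(x <- s) F x.
Proof.
move=> + F0; elim: r s => [|x r IH] s /=; first by rewrite big_nil sumr_ge0.
case/andP=> xr ur rs; have xs : x \in s by apply: rs; rewrite mem_head.
rewrite (perm_big _ (perm_to_rem xs)) !big_cons lerD2l; apply: IH => // y yr.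
have := perm_mem (perm_to_rem xs) y; rewrite rs ?inE ?yr ?orbT //.
by case: eqVneq yr => [->|//]; rewrite (negPf xr).
Qed.
(** Below a threshold d the quadratic loss at most lowers [alpha b] to [alpha b - K b * d]. If the
    product of the two lowered factors still exceeds 1, two steps would make [s true] increase
    strictly, against its monotonicity; so [s true] never gets too small. *)
Lemma alternating_growth (R : realFieldType) (s : bool -> nat -> R) (alpha t K : bool -> R) :
  (forall b n, s b n.+1 <= s b n) -> (forall b, s b 0%N = 1) ->
  (forall b, 0 < t b) -> (forall b, 0 <= K b) -> (forall b, 0 <= alpha b) ->
  (forall b n, t b * s (~~ b) n <= s b n.+1) ->
  (forall b n, alpha b * s (~~ b) n - K b * s (~~ b) n ^+ 2 <= s b n.+1) ->
  1 < alpha true * alpha false ->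
  exists2 c, 0 < c & forall n, c <= s true n.
Proof.
move=> sS s0 t0 K0 al0 st sa al1.
have spos b n : 0 < s b n.
  by elim: n b => [|n IH] b; [rewrite s0|apply: lt_le_trans (st b n); rewrite mulr_gt0].
have sle b m n : (m <= n)%N -> s b n <= s b m.
  by move=> /subnK <-; elim: (n - m)%N => // k; apply: le_trans; exact: sS.
have apos b : 0 < alpha b.
  by rewrite lt_def al0 andbT; apply/eqP; case: b => h; move: al1; rewrite h; lra.
have [d [d0 ha hb hab]] : exists d : R, [/\ 0 < d, 0 <= alpha true - K true * d,
    0 <= alpha false - K false * d &
    1 < (alpha true - K true * d) * (alpha false - K false * d)].
  have := apos true; have := apos false; have := K0 true; have := K0 false.
  move: al1; set a := alpha true; set a' := alpha false; set k := K true; set k' := K false.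
  move=> aa1 k'0 k0 a'0 a0; pose D := 1 + a * k' + a' * k.
  have D1 : 1 <= D by rewrite /D; nra.
  pose d1 := (a * a' - 1) / (2 * D); pose d2 := a / (1 + k); pose d3 := a' / (1 + k').
  have d10 : 0 < d1 by apply: divr_gt0; lra.
  have d20 : 0 < d2 by apply: divr_gt0; lra.
  have d30 : 0 < d3 by apply: divr_gt0; lra.
  have e1 : d1 * D = (a * a' - 1) / 2 by rewrite /d1; field; lra.
  have e2 : d2 * (1 + k) = a by rewrite /d2 divfK //; lra.
  have e3 : d3 * (1 + k') = a' by rewrite /d3 divfK //; lra.
  pose d := Num.min d1 (Num.min d2 d3).
  have dd0 : 0 < d by rewrite !lt_min d10 d20.
  have /andP[dd1 /andP[dd2 dd3]] : (d <= d1) && ((d <= d2) && (d <= d3)).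
    by rewrite -!le_min.
  exists d; split => //; [nra|nra|].
  have : d * D <= (a * a' - 1) / 2 by rewrite -e1; nra.
  have : 0 <= (k * d) * (k' * d) by rewrite !mulr_ge0 // ltW.
  rewrite /D; nra.
exists (d * Num.min (t true) 1); first by rewrite mulr_gt0 // lt_min t0 ltr01.
move=> N; rewrite leNgt; apply/negP => hN.
have tmin : 0 < Num.min (t true) 1 by rewrite lt_min t0 ltr01.
have [tm1 tm2] : Num.min (t true) 1 <= t true /\ Num.min (t true) 1 <= 1.
  by split; rewrite ge_min lexx ?orbT.
have h1 : s true N <= d by have := spos true N; nra.
(* The linear bound transfers smallness to the other type: [t true * s false N.+1 <= s true N.+2],
   and the latter is below [d * t true]. *)
have h2 : s false N.+1 <= d.
  have := st true N.+1; have := sS true N.+1; have := sS true N; have := spos false N.+1.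
  have := t0 true => /= t1 p1 p2 p3 p4; rewrite -(ler_pM2l t1); nra.
have := sa true N.+1; have := sa false N; have := sS true N.+1; have := sS true N.
rewrite /= => p1 p2 p3 p4.
have p5 : (alpha false - K false * d) * s true N <= s false N.+1.
  have : 0 <= K false * (s true N * (d - s true N)).
    by rewrite !mulr_ge0 ?subr_ge0 // ltW.
  move: p3; rewrite expr2; lra.
have p6 : (alpha true - K true * d) * s false N.+1 <= s true N.+2.
  have : 0 <= K true * (s false N.+1 * (d - s false N.+1)).
    by rewrite !mulr_ge0 ?subr_ge0 // ltW.
  move: p4; rewrite expr2; lra.
have : (alpha true - K true * d) * ((alpha false - K false * d) * s true N) <= s true N.+2.
  by apply: le_trans p6; rewrite ler_wpM2l.
rewrite mulrA; have := spos true N; nra.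
Qed.

Section FreeProductPercolation.
Context {R : realType} (G1 G2 : groupType) (S1 : {fset G1}) (S2 : {fset G2}).
Hypotheses (gen1 : generates S1) (gen2 : generates S2).
Notation letter := (G1 + G2)%type.
Notation G := (freeProd G1 G2).
Notation grp := (grp G1 G2).
Let S : {fset G} := freeProd_gens S1 S2.
Let X := cayley S.
Implicit Types (x y : letter) (u : seq letter) (v g : G) (b c : bool) (p : R).
Implicit Type w : config (edge X).

Definition gens b : {fset grp b} := if b return {fset grp b} then S1 else S2.

Lemma gens_generates b : generates (gens b). Proof. by case: b. Qed.

Let genS : generates S. Proof. exact: freeProd_generated. Qed.
Let cE := countable_edge genS.

Lemma emb_gens b (s : gens b) : emb (val s) \in S.
Proof.
case: b s => s; apply/fsetUP; [left|right]; apply/imfsetP; exists (val s) => //;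
  exact: valP.
Qed.

Lemma gensP (t : S) : exists b (s : gens b), val t = emb (val s).
Proof.
have /fsetUP[/imfsetP[s /= sS e]|/imfsetP[s /= sS e]] := valP t.
  by exists true, (FSetSub sS : gens true).
by exists false, (FSetSub sS : gens false).
Qed.

Definition factor_edge b (e : edge (cayley (gens b))) : edge X :=
  (emb e.1, FSetSub (emb_gens e.2)).

Lemma factor_edge_inj b : injective (@factor_edge b).
Proof.
move=> [a s] [a' s'] [/emb_inj -> /emb_inj e]; congr (_, _); exact: val_inj.
Qed.

Definition restrict b w : config (edge (cayley (gens b))) := w \o @factor_edge b.
Arguments restrict b w : clear implicits.

(** An edge multiplies by a generator of one factor; by [head_stable] it leaves the first letter
    alone unless it lies in the copy of this factor through the origin. *)
Lemma edge_cases b (e : edge X) :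
  proj b (ends e).1 = proj b (ends e).2 \/
  exists e' : edge (cayley (gens b)), factor_edge e' = e /\
    ends e' = (proj b (ends e).1, proj b (ends e).2).
Proof.
case: e => v t; have [c [s ts]] := gensP t.
rewrite /= ts.
case: (vertex_cases v c) => [[a ->]|[y [m [vE hy]]]]; last first.
  by left; have [m' e] := head_stable (val s) vE hy; rewrite /proj vE e.
rewrite -embM; case: (eqVneq c b) a s ts => [->|cb] a s ts; last first.
  by left; rewrite !proj_off.
right; exists (a, s); split; last by rewrite !projK.
by congr (_, _); apply: val_inj; rewrite /= ts.
Qed.

Lemma restrict_adj b w (e : edge X) : w e ->
  proj b (ends e).1 = proj b (ends e).2 \/
  open_adj (restrict b w) (proj b (ends e).1) (proj b (ends e).2).
Proof.
move=> we; case: (edge_cases b e) => [|[e' [h h']]]; [by left|right].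
by exists e'; split; [rewrite /restrict /= h|left].
Qed.

Lemma cluster_proj b w v v' : cluster w v v' -> cluster (restrict b w) (proj b v) (proj b v').
Proof.
by apply: (@cluster_map X (cayley (gens b)) w _ (proj b)) => e we; exact: restrict_adj.
Qed.

(** Detours outside the copy of a factor connect nothing new in it, because [proj] retracts them. *)
Lemma cluster_emb b w (a a' : grp b) :
  cluster (restrict b w) a a' <-> cluster w (emb a) (emb a').
Proof.
split=> [|/(cluster_proj b)]; last by rewrite !projK.
apply: (@cluster_map (cayley (gens b)) X _ w (@emb _ _ b)) => e we; right.
by exists (factor_edge e); split=> //; left; rewrite /= -embM.
Qed.

Lemma proj1b b : proj b (1%g : G) = 1%g :> grp b. Proof. by []. Qed.

Lemma cluster_letter b w (a : grp b) :
  cluster w 1%g (emb a) <-> cluster (restrict b w) 1%g a.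
Proof. by rewrite -(emb1 _ _ b); split=> /cluster_emb. Qed.

Lemma tau1_emb b p (a : grp b) : 0 <= p <= 1 -> tau1 S p (emb a) = tau1 (gens b) p a.
Proof.
move=> p01; have cEb := countable_edge (@gens_generates b).
rewrite /tau1 /tau -(Pr_embed cE cEb p01 (@factor_edge_inj b)
  (measurable_cluster cEb (1%g : grp b) a)).
by congr Pr; apply/seteqP; split => w /cluster_letter.
Qed.

Definition conn (v g : G) : set (config (edge X)) := [set w | cluster (X := X) w v g].

Lemma cluster_letter_depends x :
  depends_on (range (@factor_edge (side x))) (conn 1%g (fpletter x)).
Proof.
rewrite fpletterE => w w' ww' /= /cluster_letter h; apply/cluster_letter.
apply: increasing_cluster h => e; rewrite /restrict /= ww' //; by exists e.
Qed.

(** The third condition excludes the loops at [fpletter x] given by an identity generator, so that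
    these edges are disjoint from those deciding the connection from the identity to
    [fpletter x]. *)
Definition branch_edge x (e : edge X) : Prop :=
  [/\ branch x (ends e).1, branch x (ends e).2 & ~ range (@factor_edge (side x)) e].

Lemma branch_cases x (e : edge X) : let r v := if branch x v then v else fpletter x in
  r (ends e).1 = r (ends e).2 \/ branch_edge x e.
Proof.
move=> r; case: e => v t; have [c [s ts]] := gensP t; rewrite /= ts.
have rE d (a : grp d) : r (emb a) = fpletter x.
  by rewrite /r; case: ifP => // /branch_emb[].
case: (vertex_cases v c) => [[a ->]|[y [m [vE hy]]]]; first by left; rewrite -embM !rE.
have [m' e] := head_stable (val s) vE hy.
have [yx|yx] := eqVneq y x; last by left; rewrite /r /branch vE e (negPf yx).
(* Loops are set apart, since the identities of both factors embed as the same generator. *)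
have [s1|s1] := eqVneq (val s) 1%g; first by left; rewrite s1 emb1 mulg1.
right; split; rewrite /= ?ts; [by rewrite /branch vE yx|by rewrite /branch e yx|].
case=> -[a s'] _ [va st].
move: vE hy; rewrite -va yx emb_word; case: eqP => // _ [_ <-] /=.
apply/negP; rewrite negbK.
have : fpword (emb (val s')) = fpword (emb (val s)) by rewrite -ts -st.
by rewrite !emb_word (negPf s1); case: eqP => // _ [/(congr1 (@side _ _))];
  rewrite !side_inj_letter => ->.
Qed.

(* As x is a cut vertex, collapsing everything outside its branch to x is a
   retraction that only uses the edges of the branch. *)
Lemma cluster_branch w w' x g : (forall e, branch_edge x e -> w e = w' e) ->
  ~~ trivial_letter x -> branch x g -> cluster w (fpletter x) g -> cluster w' (fpletter x) g.
Proof.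
move=> ww' tx bg; pose r v := if branch x v then v else fpletter x.
rewrite -{2}[g](_ : r g = g); last by rewrite /r bg.
rewrite -{2}[fpletter x](_ : r (fpletter x) = _); last by rewrite /r branch_letter.
apply: (@cluster_map X X w w' r) => e we.
case: (branch_cases x e) => [|be]; [by left|right].
case: (be) => b1 b2 _; rewrite /r b1 b2; exists e; split; first by rewrite -ww'.
by left; case: (ends e).
Qed.

Lemma cluster_first w x g : branch x g -> cluster w 1%g g -> cluster w 1%g (fpletter x).
Proof.
move=> bg /(cluster_proj (side x)) h; rewrite fpletterE; apply/cluster_letter.
by move: h; rewrite proj1b; have [m gE] := branchP bg; rewrite {1}/proj gE.
Qed.

Definition ltau p x := tau1 S p (fpletter x).

Lemma tau1_branch p x g : 0 <= p <= 1 -> ~~ trivial_letter x -> branch x (fpletter x * g)%g ->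
  tau1 S p (fpletter x * g)%g = ltau p x * tau1 S p g.
Proof.
move=> p01 tx bg.
have m1 := measurable_cluster cE (1%g : G) (fpletter x).
have m2 := measurable_cluster cE (fpletter x) (fpletter x * g)%g.
transitivity (Pr p ((conn 1%g (fpletter x)) `&`
    conn (fpletter x) (fpletter x * g)%g)).
  congr Pr; apply/seteqP; split => w /=; last by case; exact: cluster_trans.
  move=> h; have h1 := cluster_first bg h; split=> //.
  exact: cluster_trans (cluster_sym h1) h.
rewrite (Pr_indep cE p01 m1 m2 (@cluster_letter_depends x) (D' := branch_edge x)).
- congr (_ * _); rewrite /tau1 /tau.
  rewrite -(Pr_embed cE cE p01 (shift_inj (h := fpletter x)) (measurable_cluster cE _ g)).
  congr Pr; apply/seteqP; split => w /=.
    by move=> h; apply/cluster_shift; rewrite mulg1.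
  by move/cluster_shift; rewrite mulg1.
- by move=> w w' ww'; exact: cluster_branch.
- by move=> e re [_ _]; apply.
Qed.

Lemma ltau_ge0 p x : 0 <= ltau p x. Proof. exact: tau1_ge0. Qed.

Definition wtau p u := \prod_(x <- u) ltau p x.

Lemma wtau_ge0 p u : 0 <= wtau p u.
Proof. by apply: prodr_ge0 => x _; exact: ltau_ge0. Qed.

Lemma branch_word_val x u : reduced (x :: u) -> branch x (fpletter x * word_val u)%g.
Proof. by move=> ru; rewrite -word_val_cons /branch word_valK ?eqxx. Qed.

Lemma tau1_word p u : 0 <= p <= 1 -> reduced u -> tau1 S p (word_val u) = wtau p u.
Proof.
move=> p01; elim: u => [|x u IH] ru.
  by rewrite /word_val /wtau !big_nil tau11.
have := ru; rewrite reduced_cons => /and3P[tx ru' _].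
by rewrite word_val_cons tau1_branch ?branch_word_val // IH // /wtau big_cons.
Qed.

(** * Sums over alternating words *)

Section Summability.
Variable L : bool -> seq letter.

Fixpoint words b n : seq (seq letter) :=
  [::] :: if n is m.+1 then [seq x :: u | x <- L b, u <- words (~~ b) m] else [::].

Lemma sum_wordsS p b n : \sum_(u <- words b n.+1) wtau p u =
  1 + (\sum_(x <- L b) ltau p x) * \sum_(u <- words (~~ b) n) wtau p u.
Proof.
rewrite /= big_cons {1}/wtau big_nil; congr (_ + _).
rewrite big_allpairs_dep mulr_suml; apply: eq_bigr => x _; rewrite mulr_sumr.
by apply: eq_bigr => u _; rewrite /wtau big_cons.
Qed.

(** The bound is the fixed point of the recursion [s b = 1 + al b * s (~~ b)], obtained by splitting
    off the first letter. *)
Lemma sum_words_le p (al : bool -> R) b n : (forall b, 0 <= al b) ->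
  (forall b, \sum_(x <- L b) ltau p x <= al b) -> al true * al false < 1 ->
  \sum_(u <- words b n) wtau p u <= (1 + al b) / (1 - al true * al false).
Proof.
move=> al0 hL al1; have D0 : 0 < 1 - al true * al false by lra.
have alb c : al c * al (~~ c) = al true * al false by case: c; rewrite //= mulrC.
elim: n b => [|n IH] b.
  rewrite big_seq1 /wtau big_nil ler_pdivlMr //.
  have := al0 b; have := mulr_ge0 (al0 true) (al0 false); lra.
rewrite sum_wordsS.
apply: (@le_trans _ _ (1 + al b * ((1 + al (~~ b)) / (1 - al true * al false)))).
  rewrite lerD2l; apply: ler_pM => //.
    by apply: sumr_ge0 => x _; exact: ltau_ge0.
  by apply: sumr_ge0 => u _; exact: wtau_ge0.
by rewrite le_eqVlt -(alb b); apply/orP; left; apply/eqP; field; rewrite alb; lra.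
Qed.

Lemma mem_words b n u : reduced u -> (size u <= n)%N ->
  (forall x, x \in u -> x \in L (side x)) ->
  (if u is x :: _ then side x = b else True) -> u \in words b n.
Proof.
have nilP c m : [::] \in words c m by case: m => [|m]; exact: mem_head.
elim: n b u => [|n IH] b [|x u] //.
rewrite [size _]/= ltnS reduced_cons => /and3P[_ ru hu] un hL xb; rewrite inE /=.
apply/allpairsP; exists (x, u); split=> //=.
  by rewrite -xb; apply: hL; rewrite mem_head.
apply: IH => // [y yu|]; first by apply: hL; rewrite inE yu orbT.
by case: (u) hu => // y u' /=; rewrite xb; case: b {xb} (side y) => [] [].
Qed.

End Summability.

Lemma sum_ltau_factor p b (s : seq letter) : 0 <= p <= 1 -> all (fun x => side x == b) s ->
  \sum_(x <- s) ltau p x = \sum_(a <- [seq letter_coord b x | x <- s]) tau1 (gens b) p a.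
Proof.
move=> p01 /allP hs; rewrite big_map big_seq [RHS]big_seq; apply: eq_bigr => x /hs /eqP xb.
by rewrite /ltau fpletterE xb tau1_emb.
Qed.

Lemma summable_free_product p (al : bool -> R) : 0 <= p <= 1 -> (forall b, 0 <= al b) ->
  (forall b (r : seq (grp b)), uniq r -> 1%g \notin r ->
     \sum_(a <- r) tau1 (gens b) p a <= al b) ->
  al true * al false < 1 ->
  exists M, forall r : seq G, uniq r -> \sum_(g <- r) tau1 S p g <= M.
Proof.
move=> p01 al0 hal al1.
pose M b := (1 + al b) / (1 - al true * al false).
exists (M true + M false) => r ur.
(* The alphabets consist of the letters occurring in [r]; they depend on [r], but the bound [al b]
   on their weights does not. *)
pose L b := undup [seq x <- flatten [seq fpword g | g <- r] |
  (side x == b) && ~~ trivial_letter x].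
have hL b : \sum_(x <- L b) ltau p x <= al b.
  have sL x : x \in L b -> side x = b /\ ~~ trivial_letter x.
    by rewrite mem_undup mem_filter => /andP[/andP[/eqP]].
  rewrite (sum_ltau_factor (b := b)) //; last by apply/allP => x /sL[->].
  apply: hal.
    rewrite map_inj_in_uniq ?undup_uniq // => x y /sL[xb _] /sL[yb _] e.
    by rewrite -(inj_letterK xb) e inj_letterK.
  apply/mapP => -[x /sL[xb tx] e].
  by move: tx; rewrite -(inj_letterK xb) trivial_inj_letter -e eqxx.
pose n := \max_(g <- r) size (fpword g).
have -> : \sum_(g <- r) tau1 S p g = \sum_(u <- [seq fpword g | g <- r]) wtau p u.
  rewrite big_map; apply: eq_bigr => g _.
  by rewrite -tau1_word ?fpwordK //; exact: fpwordP.
apply: (@le_trans _ _ (\sum_(u <- words L true n ++ words L false n) wtau p u)).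
  apply: ler_sum_subset; first by rewrite map_inj_uniq //; exact: val_inj.
    exact: wtau_ge0.
  move=> _ /mapP[g gr ->]; rewrite mem_cat.
  have hn : (size (fpword g) <= n)%N by exact: (@leq_bigmax_seq _ _ predT _ g gr isT).
  have hg x : x \in fpword g -> x \in L (side x).
    move=> xg; rewrite mem_undup mem_filter eqxx /=; apply/andP; split.
      by have /andP[/allP/(_ x xg)] := fpwordP g.
    by apply/flattenP; exists (fpword g) => //; exact: map_f.
  have [c hc] : exists c, if fpword g is x :: _ then side x = c else True.
    by case: (fpword g) => [|x u]; [exists true|exists (side x)].
  have := mem_words (fpwordP g) hn hg hc.
  by case: c {hc} => ->; rewrite ?orbT.
by rewrite big_cat; apply: lerD; exact: sum_words_le.
Qed.

(** * Survival of the two-type branching structure *)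

Section Survival.
Variable A : bool -> seq letter.
Hypothesis A_uniq : forall b, uniq (A b).
Hypothesis AP : forall b x, x \in A b -> side x = b /\ ~~ trivial_letter x.

(** Words of length exactly n, the n-th generation, whereas [words] also contains the shorter
    ones. *)
Fixpoint xwords b n : seq (seq letter) :=
  if n is m.+1 then [seq x :: u | x <- A b, u <- xwords (~~ b) m] else [:: [::]].

Lemma xwordsP b n u : u \in xwords b n ->
  [/\ reduced u, size u = n & if u is x :: _ then side x = b else True].
Proof.
elim: n b u => [|n IH] b u /=; first by rewrite inE => /eqP ->.
case/allpairsP => -[x v] /= [/AP[xb tx] /IH[rv <- hv] ->]; split=> //.
rewrite reduced_cons tx rv /=; case: (v) hv => // y v' ->.
by rewrite xb; case: (b).
Qed.

Definition survive b n : set (config (edge X)) :=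
  some_of (xwords b n) (fun u => conn 1%g (word_val u)).

Definition survive_via n x : set (config (edge X)) :=
  some_of (xwords (~~ side x) n) (fun u => conn (fpletter x) (fpletter x * word_val u)%g).

Lemma measurable_conn v g : measurable (conn v g).
Proof. exact: measurable_cluster. Qed.

Lemma measurable_survive b n : measurable (survive b n).
Proof. by apply: measurable_some_of => u; exact: measurable_conn. Qed.

Lemma measurable_survive_via n x : measurable (survive_via n x).
Proof. by apply: measurable_some_of => u; exact: measurable_conn. Qed.

Lemma survive_viaE n x w : survive_via n x w <->
  survive (~~ side x) n (w \o shift (fpletter x) : config (edge X)).
Proof.
split=> -[u hu]; rewrite /conn /= => h; exists u => //.
  by rewrite /conn /=; apply/cluster_shift; rewrite mulg1.
by move/cluster_shift: h; rewrite mulg1.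
Qed.

Lemma Pr_survive_via p n x : 0 <= p <= 1 ->
  Pr p (survive_via n x) = Pr p (survive (~~ side x) n).
Proof.
move=> p01; rewrite -(Pr_embed cE cE p01 (shift_inj (h := fpletter x))
  (measurable_survive _ n)).
by congr Pr; apply/seteqP; split => w /= /survive_viaE.
Qed.

Lemma xwords_cons b x n u : x \in A b -> u \in xwords (~~ b) n -> reduced (x :: u).
Proof.
move=> xA un; have /xwordsP[] // : x :: u \in xwords b n.+1.
by apply/allpairsP; exists (x, u).
Qed.

Lemma survive_via_depends n b x : x \in A b ->
  depends_on (branch_edge x) (survive_via n x).
Proof.
move=> xA w w' ww' [u hu h]; exists u => //.
have [xb tx] := AP xA; rewrite xb in hu.
by apply: cluster_branch ww' tx _ h; apply: branch_word_val; exact: xwords_cons xA hu.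
Qed.

Lemma surviveS b n :
  survive b n.+1 = some_of (A b) (fun x => conn 1%g (fpletter x) `&` survive_via n x).
Proof.
apply/seteqP; split => w.
  case=> u /allpairsP[[x v] /= [xA vn ->]]; rewrite /conn /= word_val_cons => h.
  have h1 := cluster_first (branch_word_val (xwords_cons xA vn)) h.
  exists x => //; split=> //; exists v; first by have [-> _] := AP xA.
  exact: cluster_trans (cluster_sym h1) h.
case=> x xA [h1 [v vn h2]]; exists (x :: v).
  by apply/allpairsP; exists (x, v); split=> //=; have [<- _] := AP xA.
by rewrite /conn /= word_val_cons; exact: cluster_trans h1 h2.
Qed.

Lemma survive0 b : survive b 0 = setT.
Proof.
apply/seteqP; split => // w _; exists [::]; first by rewrite inE.
by rewrite /conn /= /word_val big_nil; exact: rt_refl.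
Qed.

Lemma survive_nonincreasing b n : survive b n.+1 `<=` survive b n.
Proof.
elim: n b => [|n IH] b; first by rewrite survive0.
rewrite [X in X `<=` _]surviveS surviveS => w [x xA [h1 h2]]; exists x => //; split=> //.
by apply/survive_viaE/IH/survive_viaE.
Qed.

Lemma Pr_conn_survive_via p n b x : 0 <= p <= 1 -> x \in A b ->
  Pr p (conn 1%g (fpletter x) `&` survive_via n x) = ltau p x * Pr p (survive (~~ b) n).
Proof.
move=> p01 xA; have [xb tx] := AP xA.
rewrite (Pr_indep cE p01 (measurable_conn _ _) (measurable_survive_via _ _)
  (@cluster_letter_depends x) (@survive_via_depends n b x xA)).
  by rewrite Pr_survive_via // xb.
by move=> e re [_ _]; apply.
Qed.

Lemma survival p : 0 <= p <= 1 -> (forall b x, x \in A b -> 0 < ltau p x) ->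
  1 < (\sum_(x <- A true) ltau p x) * (\sum_(x <- A false) ltau p x) ->
  exists2 c, 0 < c & forall n, c <= Pr p (survive true n).
Proof.
move=> p01 tA hA; pose s b n := Pr p (survive b n).
pose al b := \sum_(x <- A b) ltau p x.
have al0 b : 0 <= al b by apply: sumr_ge0 => x _; exact: ltau_ge0.
have An b : exists x, x \in A b.
  case E: (A b) => [|x l]; last by exists x; rewrite mem_head.
  by move: hA; case: b E => ->; rewrite big_nil ?mul0r ?mulr0 ltr10.
(* One letter of each alphabet already gives the linear lower bound with a positive coefficient that
   [alternating_growth] requires. *)
pose a b := projT1 (cid (An b)).
have aA b : a b \in A b by rewrite /a; case: cid.
have mI n x := measurableI _ _ (measurable_conn 1%g (fpletter x)) (measurable_survive_via n x).
apply: (@alternating_growth R s al (fun b => ltau p (a b)) (fun b => (size (A b))%:R ^+ 2)) => //.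
- move=> b n; apply: le_Pr; [exact: measurable_survive..|exact: survive_nonincreasing].
- by move=> b; rewrite /s survive0 PrT.
- by move=> b; exact: tA (aA b).
- move=> b n; rewrite /s -Pr_conn_survive_via //; apply: le_Pr => //.
    exact: measurable_survive.
  by move=> w h; rewrite surviveS; exists (a b).
move=> b n.
have t0 : 0 <= s (~~ b) n ^+ 2 by rewrite exprn_ge0 // Pr_ge0.
rewrite [leRHS]/s surviveS.
apply: le_trans (Bonferroni_ge (mI n) (A_uniq b) t0 _).
  rewrite lerB // mulr_suml big_seq [leRHS]big_seq; apply: ler_sum => x xA.
  by rewrite (Pr_conn_survive_via _ p01 xA).
(* Distinct letters have disjoint branches, so survival through both costs the square of one
   survival probability. *)
move=> x y xA yA xy.
have [xb tx] := AP xA; have [yb ty] := AP yA.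
apply: (@le_trans _ _ (Pr p (survive_via n x `&` survive_via n y))).
  apply: le_Pr; [by apply: measurableI|by apply: measurableI; exact: measurable_survive_via|].
  by move=> w [[_ ?] [_ ?]].
rewrite (Pr_indep cE p01 (measurable_survive_via _ _) (measurable_survive_via _ _)
  (@survive_via_depends n b x xA) (@survive_via_depends n b y yA)).
  by rewrite !Pr_survive_via // xb yb -expr2.
move=> e [/branchP[u eu] _ _] [/branchP[v ev] _ _].
by move: ev xy; rewrite eu => -[->]; rewrite eqxx.
Qed.

(** The events decrease, so their intersection has probability at least [c]; on it the cluster
    contains words of every length. *)
Lemma theta_ge_survive p (c : R) : (forall n, c <= Pr p (survive true n)) ->
  (c%:E <= theta (X := X) 1%g p)%E.
Proof.
move=> hc.
have mS n := measurable_survive true n.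
have ndS : {homo survive true : n m / (n <= m)%N >-> (m <= n)%O}.
  move=> n m /subnK <-; apply/subsetPset; elim: (m - n)%N => [//|k IH].
  by rewrite addSn => w /survive_nonincreasing; exact: IH.
have mI := bigcapT_measurable mS.
have cv := nonincreasing_cvg_mu (mu := percolation (edge X) p) (F := survive true) _ mS mI ndS.
apply: (@le_trans _ _ (percolation (edge X) p (\bigcap_n survive true n))).
  rewrite -(cvg_lim _ (cv _)) //; last by rewrite -ge0_fin_numE // fin_num_measure.
  apply: lime_ge.
    by apply: (cvgP _ (cv _)); rewrite -ge0_fin_numE // fin_num_measure.
  by apply: nearW => n /=; rewrite PrE // lee_fin.
apply: le_measure; rewrite ?inE //.
  exact: (measurable_infinite_cluster cE (countable_vertex genS)).
move=> w hw fin; pose r := fset_set (cluster w (1%g : G)).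
have [u /xwordsP[ru su _] h] := hw (\max_(g <- r) size (fpword g)).+1 I.
have : word_val u \in r by rewrite in_fset_set // inE.
move=> ur; have := @leq_bigmax_seq _ (enum_fset r) predT (fun g : G => size (fpword g)) _ ur isT.
by rewrite word_valK // su ltnn.
Qed.

End Survival.

End FreeProductPercolation.

(** * The critical probability *)

Section Excess.
Context {R : realType} (G : groupType) (S : {fset G}).
Hypothesis genS : generates S.
Implicit Types (p : R) (x : G) (r : seq G).
Let X := cayley S.
Let cE := countable_edge genS.
Let full : config (edge X) := fun=> true.

(** The vertices connected to the identity when all edges are open form a subgroup containing the
    generators. *)
Let cluster_full x : cluster full (1%g : G) x.
Proof.
have shift_full h y z : cluster full y z -> cluster full (h * y)%g (h * z)%g.
  by move=> c; apply/cluster_shift.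
have /asboolP // : x \in [pred x : G | `[< cluster full (1%g : G) x >]].
apply: genS => [|s sS]; last first.
  apply/asboolP/rt_step; exists (1%g, FSetSub sS); split=> //.
  by left; rewrite /= mul1g.
split=> [|y z /asboolP hy /asboolP hz]; first by apply/asboolP; exact: rt_refl.
apply/asboolP; apply: (cluster_trans hy); apply: cluster_sym.
have := shift_full (y * z^-1)%g _ _ hz; by rewrite mulg1 mulgVK.
Qed.

(** With [k] independent of [p], this yields both positivity for [p > 0] and the value 1 at
    [p = 1]. *)
Lemma tau1_ge_exp x : exists k, forall p, 0 <= p <= 1 -> p ^+ k <= tau1 S p x.
Proof.
have /clusterP[n hn] := cluster_full x.
pose F := touching (@incident _ S) (ball (@incident _ S) (1%g : vertex X) n).
have uF : uniq F by exact: undup_uniq.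
exists (size F) => p p01; rewrite -(Pr_cylinder cE) //; apply: le_Pr.
- exact: measurable_cylinder.
- exact: measurable_cluster.
move=> w hw; apply/clusterP; exists n.
by apply: (@depends_on_reach X _ (@incidentP _ S) 1%g n x full w _ hn) => e /hw ->.
Qed.

Lemma tau1_gt0 p x : 0 < p <= 1 -> 0 < tau1 S p x.
Proof.
case/andP=> p0 p1; have [k hk] := tau1_ge_exp x.
by apply: lt_le_trans (hk p _); rewrite ?exprn_gt0 // ltW.
Qed.

Lemma tau1_p1 x : tau1 S (1 : R) x = 1.
Proof.
have [k hk] := tau1_ge_exp x; apply/eqP; rewrite eq_le; apply/andP; split.
  by apply: Pr_le1; exact: measurable_cluster.
by rewrite -{1}(expr1n R k) hk // ler01 lexx.
Qed.

(** Parameter 0 is a thinning of itself, so the value is at most [c] times itself with [c < 1]. *)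
Lemma tau1_p0 x : x != 1%g -> tau1 S (0 : R) x = 0.
Proof.
move=> x1; have [|c c01 hc] := tau1_thin_strict genS (q := 0 : R).
  by rewrite lexx ltr01.
have := hc 0 x; rewrite mul0r lexx ler01 => /(_ isT x1).
by have := tau1_ge0 S (0 : R) x; move=> h1 h2; nra.
Qed.

Definition excess p : \bar R := (chi S p - 1)%E.

Lemma excess_ge p r : uniq r -> 1%g \notin r ->
  ((\sum_(x <- r) tau1 S p x)%:E <= excess p)%E.
Proof.
by move=> ur r1; rewrite leeBrDr // -EFinD addrC; exact: chi_ge.
Qed.

Lemma excess_le p (M : R) :
  (forall r, uniq r -> 1%g \notin r -> \sum_(x <- r) tau1 S p x <= M) ->
  (excess p <= M%:E)%E.
Proof. by move=> hM; rewrite leeBlDr // -EFinD addrC; exact: chi_le. Qed.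

Lemma excess_ge0 p : (0 <= excess p)%E.
Proof. by have := @excess_ge p [::] isT isT; rewrite big_nil. Qed.

Hypothesis ntG : nontrivial G.

Lemma excess_gt0 p : 0 < p <= 1 -> (0 < excess p)%E.
Proof.
move=> p01; have [g /eqP g1] := ntG; apply: (@lt_le_trans _ _ (tau1 S p g)%:E).
  by rewrite lte_fin tau1_gt0.
by have := @excess_ge p [:: g]; rewrite big_seq1 inE eq_sym; exact.
Qed.

Lemma excess_p1 : (1 <= excess (1 : R))%E.
Proof.
have [g /eqP g1] := ntG.
by have := @excess_ge 1 [:: g]; rewrite big_seq1 inE eq_sym tau1_p1; exact.
Qed.

(** The factor of [tau1_thin_strict] is uniform in the vertex, hence survives the supremum over
    lists. *)
Lemma excess_strict p p' (a : R) : 0 <= p -> p < p' -> p' <= 1 -> excess p' = a%:E ->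
  exists2 c, 0 <= c < 1 & (excess p <= (c * a)%:E)%E.
Proof.
move=> p0 pp' p'1 ha; have p'0 : 0 < p' by exact: le_lt_trans pp'.
have [|c c01 hc] := tau1_thin_strict genS (q := p / p').
  by rewrite ltr_pdivrMr // mul1r pp' andbT divr_ge0 // ltW.
exists c => //; apply: excess_le => r ur r1.
have : \sum_(x <- r) tau1 S p' x <= a by rewrite -lee_fin -ha excess_ge.
move=> h; apply: (@le_trans _ _ (c * \sum_(x <- r) tau1 S p' x)).
  rewrite mulr_sumr big_seq [leRHS]big_seq; apply: ler_sum => x xr.
  rewrite {1}(_ : p = p' * (p / p')); last by rewrite mulrC divfK // gt_eqF.
  apply: hc; first by rewrite p'1 ltW.
  by apply: contraNneq r1 => <-.
by apply: ler_wpM2l => //; case/andP: c01.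
Qed.

End Excess.

(** If all products of finite sums were at most 1, a one-element list would make the excess of [S']
    finite, and then that of [S] would be at most its inverse. *)
Lemma excess_prod_gt1 (R : realType) (G G' : groupType) (S : {fset G}) (S' : {fset G'})
    (p : R) : generates S -> generates S' -> nontrivial G -> nontrivial G' -> 0 < p <= 1 ->
  (1 < excess S p * excess S' p)%E ->
  exists r r', [/\ uniq r, 1%g \notin r, uniq r', 1%g \notin r' &
    1 < (\sum_(x <- r) tau1 S p x) * (\sum_(x <- r') tau1 S' p x)].
Proof.
move=> gS gS' nG nG' p01 h; apply: contrapT => hn.
have le1 r r' : uniq r -> 1%g \notin r -> uniq r' -> 1%g \notin r' ->
    (\sum_(x <- r) tau1 S p x) * (\sum_(x <- r') tau1 S' p x) <= 1.
  by move=> *; rewrite leNgt; apply/negP => ?; apply: hn; exists r, r'.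
have [g /eqP g1] := nG.
have tg : 0 < tau1 S p g by exact: tau1_gt0.
have e2 := excess_gt0 gS' nG' p01.
have : (excess S' p <= (tau1 S p g)^-1%:E)%E.
  apply: (excess_le gS') => r' ur' r'1; rewrite -[leRHS]mul1r ler_pdivlMr // mulrC.
  by have := le1 [:: g] r'; rewrite big_seq1 inE eq_sym; exact.
case E : (excess S' p) e2 h => [b| |] // b0 h _.
rewrite lte_fin in b0.
have : (excess S p <= b^-1%:E)%E.
  apply: (excess_le gS) => r ur r1; rewrite -[leRHS]mul1r ler_pdivlMr //.
  have s0 : 0 <= \sum_(x <- r) tau1 S p x by apply: sumr_ge0 => x _; exact: tau1_ge0.
  have [->|sN0] := eqVneq (\sum_(x <- r) tau1 S p x) 0; first by rewrite mul0r.
  have sp : 0 < \sum_(x <- r) tau1 S p x by rewrite lt_def sN0.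
  rewrite mulrC -ler_pdivlMr // mul1r -lee_fin -E; apply: (excess_le gS') => r' ur' r'1.
  by rewrite -[leRHS]mul1r ler_pdivlMr // mulrC; exact: le1.
move=> h'; move: h; rewrite ltNge => /negP; apply.
apply: (@le_trans _ _ (b^-1%:E * b%:E)%E); first by rewrite lee_pmul2r // lte_fin.
by rewrite -EFinM mulVf // gt_eqF.
Qed.

(** * Behaviour on both sides of the critical value *)

Section Critical.
Context {R : realType} (G1 G2 : groupType) (S1 : {fset G1}) (S2 : {fset G2}).
Hypotheses (gen1 : generates S1) (gen2 : generates S2).
Hypotheses (ntG1 : nontrivial G1) (ntG2 : nontrivial G2).
Let S : {fset freeProd G1 G2} := freeProd_gens S1 S2.
Let X := cayley S.
Let genS : generates S. Proof. exact: freeProd_generated. Qed.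
Implicit Types p : R.

Definition percolating : set R := [set p : R | 0 <= p <= 1 /\ (0 < theta (X := X) 1%g p)%E].

Notation gens := (gens S1 S2).

Lemma grp_nontrivial b : nontrivial (grp G1 G2 b). Proof. by case: b. Qed.

Lemma theta_gt0_survive p (r : forall b, seq (grp G1 G2 b)) (c : R) : 0 < c ->
  (forall n, c <= Pr p (survive (S1 := S1) (S2 := S2)
    (fun b => [seq inj_letter a | a <- r b]) true n)) ->
  (forall b, 1%g \notin r b) -> (0 < theta (X := X) 1%g p)%E.
Proof.
move=> c0 hc r1; apply: lt_le_trans (theta_ge_survive gen1 gen2 _ hc); first by rewrite lte_fin.
move=> b x /mapP[a ar ->]; rewrite side_inj_letter trivial_inj_letter; split=> //.
by apply: contraNneq (r1 b) => <-.
Qed.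

Lemma percolating1 : percolating 1.
Proof.
split; first by rewrite ler01 lexx.
have nt b : exists a : grp G1 G2 b, a <> 1%g by exact: grp_nontrivial.
pose a b := projT1 (cid (nt b)).
have a1 b : 1%g != a b by rewrite eq_sym; apply/eqP; rewrite /a; case: cid.
apply: (@theta_gt0_survive 1 (fun b => [:: a b]) 1) => [//|n|b]; last by rewrite inE.
pose A b := [seq inj_letter a' | a' <- [:: a b]].
have [u hu] : exists u, u \in xwords A true n.
  elim: n true => [|n IH] b; first by exists [::]; rewrite inE.
  have [u hu] := IH (~~ b); exists (inj_letter (a b) :: u); apply/allpairsP.
  by exists (inj_letter (a b), u); rewrite /= inE eqxx.
apply: (@le_trans _ _ (tau1 S 1 (word_val u))); first by rewrite tau1_p1.
apply: le_Pr.
- exact: measurable_cluster (countable_edge genS) _ _.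
- exact: measurable_survive.
- by move=> w hw; exists u.
Qed.

Lemma supercritical p : 0 < p <= 1 -> (1 < excess S1 p * excess S2 p)%E ->
  exists2 p', p' < p & percolating p'.
Proof.
move=> p01 h.
have [r1 [r2 [u1 n1 u2 n2 hr]]] := excess_prod_gt1 gen1 gen2 ntG1 ntG2 p01 h.
have p01' : 0 <= p <= 1 by case/andP: p01 => /ltW -> ->.
move: hr; set a := \sum_(x <- r1) _; set b := \sum_(x <- r2) _ => ab1.
have a0 : 0 <= a by apply: sumr_ge0 => x _; exact: tau1_ge0.
have b0 : 0 <= b by apply: sumr_ge0 => x _; exact: tau1_ge0.
have ap : 0 < a by rewrite lt_def a0 andbT; apply/eqP => z; move: ab1; rewrite z; lra.
have bp : 0 < b by rewrite lt_def b0 andbT; apply/eqP => z; move: ab1; rewrite z; lra.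
(* Then [(a - e) * (b - e) >= a * b - e * (a + b) = (a * b + 1) / 2 > 1], so a loss of [e] in each
   sum is affordable. *)
pose e := (a * b - 1) / (2 * (a + b)).
have e0 : 0 < e by apply: divr_gt0; lra.
have eE : e * (a + b) = (a * b - 1) / 2 by rewrite /e; field; lra.
have ea : e <= a by nra.
have eb : e <= b by nra.
have [q1 /andP[q10 q11] h1] := sum_tau1_left gen1 r1 p01' e0.
have [q2 /andP[q20 q21] h2] := sum_tau1_left gen2 r2 p01' e0.
(* The midpoint lies strictly between 0 and 1, so that [p * q] is positive and strictly below
   [p]. *)
pose q := (1 + Num.max q1 q2) / 2.
have [m1 m2] : q1 <= Num.max q1 q2 /\ q2 <= Num.max q1 q2.
  by rewrite !le_max !lexx orbT.
have m3 : Num.max q1 q2 < 1 by rewrite gt_max q11.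
have [k1 k2 k3 k4] : [/\ q1 <= q <= 1, q2 <= q <= 1, 0 < q & q < 1].
  by rewrite /q; split; lra.
have {h1} h1 := h1 q k1; have {h2} h2 := h2 q k2.
have pq : 0 < p * q <= 1 by nra.
have pq' : 0 <= p * q <= 1 by case/andP: pq => /ltW -> ->.
exists (p * q); first by nra.
split=> //.
pose r b' : seq (grp G1 G2 b') := if b' return seq (grp G1 G2 b') then r1 else r2.
have rP b' : uniq (r b') /\ 1%g \notin r b' by case: b'.
pose A b' := [seq inj_letter a' | a' <- r b'].
have [||||c c0 hc] := @survival R G1 G2 S1 S2 gen1 gen2 A _ _ (p * q) pq'.
- by move=> b'; rewrite map_inj_uniq; [case: (rP b')|exact: can_inj (letter_coordK (b := b'))].
- move=> b' x /mapP[a' ar ->]; rewrite side_inj_letter trivial_inj_letter; split=> //.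
  by apply: contraNneq (rP b').2 => <-.
- by move=> b' x _; exact: tau1_gt0.
- have sE b' : \sum_(x <- A b') ltau S1 S2 (p * q) x =
      \sum_(a' <- r b') tau1 (gens b') (p * q) a'.
    by rewrite big_map; apply: eq_bigr => a' _; exact: tau1_emb.
  rewrite !sE /=.
  have : (a - e) * (b - e) <= (\sum_(x <- r1) tau1 S1 (p * q) x) *
      (\sum_(x <- r2) tau1 S2 (p * q) x).
    by apply: ler_pM => //; rewrite subr_ge0.
  apply: lt_le_trans; nra.
- by apply: (theta_gt0_survive c0 hc) => b'; case: (rP b').
Qed.

(** The expected size is still finite at some [p' > p], hence at every parameter below [p'], where
    theta therefore vanishes. *)
Lemma subcritical p (al : bool -> R) : 0 <= p < 1 -> (forall b, 0 <= al b) ->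
  (forall b (r : seq (grp G1 G2 b)), uniq r -> 1%g \notin r ->
     \sum_(a <- r) tau1 (gens b) p a <= al b) ->
  al true * al false < 1 ->
  exists2 p', p < p' & forall t, percolating t -> p' <= t.
Proof.
move=> p01 al0 hal al1.
have p01' : 0 <= p <= 1 by case/andP: p01 => -> /ltW.
have [M hM] := summable_free_product gen1 gen2 p01' al0 hal al1.
have [p' [M' [pp' p'1 hM']]] := summable_tau1_open genS p01 hM.
exists p' => // t [/andP[t0 t1] th]; rewrite leNgt; apply/negP => tp'.
have := theta_eq0 (countable_edge genS) (countable_vertex genS) (o := 1%g) (p := t) (M := M').
move=> h; move: th; rewrite h ?ltxx // => r ur.
apply: le_trans (hM' r ur); apply: ler_sum => x _.
by apply: le_tau1 => //; exact: ltW.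
Qed.

Let pc : R := cayley_pc S.

Let pcE : pc = inf percolating. Proof. by []. Qed.

Let has_inf_percolating : has_inf percolating.
Proof.
by split; [exists 1; exact: percolating1|exists 0 => t [/andP[]]].
Qed.

Lemma pc_le p : percolating p -> pc <= p.
Proof. by move=> hp; rewrite pcE; apply: ge_inf => //; case: has_inf_percolating. Qed.

Lemma lt_pc p p' : p < p' -> (forall t, percolating t -> p' <= t) -> p < pc.
Proof.
move=> pp' h; apply: lt_le_trans pp' _; rewrite pcE; apply: lb_le_inf.
  by exists 1; exact: percolating1.
exact: h.
Qed.

Lemma pc_gt0 : 0 < pc.
Proof.
have [p' p0 h] : exists2 p' : R, 0 < p' & forall t, percolating t -> p' <= t.
  have p01 : 0 <= (0 : R) < 1 by rewrite lexx ltr01.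
  have al1 : (fun=> 0 : R) true * (fun=> 0 : R) false < 1 by rewrite mul0r.
  apply: (subcritical p01 (al := fun=> 0) _ _ al1) => [//|b r _ r1].
  rewrite big_seq big1 // => a ar; apply: tau1_p0; first exact: gens_generates.
  by apply: contraNneq r1 => <-.
exact: lt_pc p0 h.
Qed.

Lemma pc_le1 : pc <= 1. Proof. exact: pc_le percolating1. Qed.

Lemma excess_pc : (excess S1 pc * excess S2 pc = 1)%E.
Proof.
have p01 : 0 < pc <= 1 by rewrite pc_gt0 pc_le1.
apply/eqP; rewrite eq_le; apply/andP; split; rewrite leNgt; apply/negP => h.
  by have [p' pp' /pc_le] := supercritical p01 h; rewrite leNgt pp'.
have e1 := excess_gt0 gen1 ntG1 p01; have e2 := excess_gt0 gen2 ntG2 p01.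
case E1 : (excess S1 pc) e1 h => [a| |] // a0 h; last first.
  by move: h; rewrite gt0_mulye.
case E2 : (excess S2 pc) e2 h => [b| |] // b0 h; last first.
  by move: h; rewrite gt0_muley.
rewrite !lte_fin in a0 b0; rewrite -EFinM lte_fin in h.
have pc1 : pc < 1.
  rewrite lt_def pc_le1 andbT; apply/eqP => pc1.
  have := excess_p1 gen1 ntG1 (R := R); have := excess_p1 gen2 ntG2 (R := R).
  by rewrite pc1 E1 E2 !lee_fin => ? ?; nra.
have [p' pp' hp'] : exists2 p', pc < p' & forall t, percolating t -> p' <= t.
  apply: (subcritical (al := fun c : bool => if c then a else b)) => //.
  - by rewrite ltW // pc_gt0.
  - by case; exact: ltW.
  - case=> r ur r1; rewrite -lee_fin.
      by rewrite -E1; exact: excess_ge.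
    by rewrite -E2; exact: excess_ge.
by have := lt_pc pp' hp'; rewrite ltxx.
Qed.

Lemma excess_unique p p' : 0 < p -> p < p' -> p' <= 1 ->
  (excess S1 p * excess S2 p = 1)%E -> (excess S1 p' * excess S2 p' = 1)%E -> False.
Proof.
move=> p0 pp' p'1 h h'.
have p01 : 0 < p' <= 1 by rewrite p'1 (lt_trans p0).
have p01' : 0 < p <= 1 by rewrite p0 (le_trans (ltW pp')).
have := excess_gt0 gen1 ntG1 p01; have := excess_gt0 gen2 ntG2 p01.
case E1 : (excess S1 p') h' => [a| |] // h'; last first.
  by move=> e2; move: h'; rewrite gt0_mulye.
case E2 : (excess S2 p') h' => [b| |] // h'; last first.
  by move=> _ e1; move: h'; rewrite gt0_muley.
rewrite !lte_fin => b0 a0; move: h' => [ab].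
have [c /andP[c0 c1] hc] := excess_strict gen1 (ltW p0) pp' p'1 E1.
have [d /andP[d0 d1] hd] := excess_strict gen2 (ltW p0) pp' p'1 E2.
have : (excess S1 p * excess S2 p <= (c * a)%:E * (d * b)%:E)%E.
  by apply: lee_pmul => //; exact: excess_ge0.
by rewrite h -EFinM lee_fin mulrACA ab mulr1; nra.
Qed.

End Critical.

Theorem theorem1 (R : realType) (G1 G2 : groupType)
  (S1 : {fset G1}) (S2 : {fset G2})
  (hG1 : nontrivial G1) (hG2 : nontrivial G2)
  (hS1 : generates S1) (hS2 : generates S2) :
  let pc : R := cayley_pc (freeProd_gens S1 S2) in
  0 < pc <= 1 /\
  unique (fun p : R => 0 < p <= 1 /\
            ((chi S1 p - 1) * (chi S2 p - 1) = 1)%E) pc.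
Proof.
move=> pc.
have pc0 : 0 < pc by exact: pc_gt0.
have pc1 : pc <= 1 by exact: pc_le1.
have epc := excess_pc hS1 hS2 hG1 hG2 (R := R).
have pc01 : 0 < pc <= 1 by rewrite pc0.
split=> //; split=> [//|p [/andP[p0 p1] ep]].
have [pp|pp|//] := ltgtP pc p.
  by case: (excess_unique hS1 hS2 hG1 hG2 pc0 pp p1 epc ep).
by case: (excess_unique hS1 hS2 hG1 hG2 p0 pp pc1 ep epc).
Qed.
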